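(* Fix $n \geq 0$ and let $B \subseteq \omega$ be a set which is not $\Sigma^0_{n+1}$. Then for every set $A \subseteq \omega$ there is an infinite set $G$ with $G \subseteq A$ or $G \subseteq \omega \setminus A$ such that $B$ is not $\Sigma^0_{n+1}(G)$. *)

(* Defs.v *)
From Stdlib Require Import List Arith.
Import ListNotations.

Inductive prf : Type :=
| PZero
| PSucc
| PProj (i : nat)
| POracle
| PComp (f : prf) (gs : list prf)
| PPrimRec (f g : prf)
| PMu (f : prf).

Inductive eval (X : nat -> Prop) : prf -> list nat -> nat -> Prop :=
| ev_zero : forall v, eval X PZero v 0
| ev_succ : forall v, eval X PSucc v (S (hd 0 v))
| ev_proj : forall i v, eval X (PProj i) v (nth i v 0)
| ev_oracle_in : forall v, X (hd 0 v) -> eval X POracle v 1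
| ev_oracle_out : forall v, ~ X (hd 0 v) -> eval X POracle v 0
| ev_comp : forall f gs v ys z,
    Forall2 (fun g y => eval X g v y) gs ys ->
    eval X f ys z -> eval X (PComp f gs) v z
| ev_prim0 : forall f g v z, eval X f v z -> eval X (PPrimRec f g) (0 :: v) z
| ev_primS : forall f g n v r z,
    eval X (PPrimRec f g) (n :: v) r ->
    eval X g (n :: r :: v) z -> eval X (PPrimRec f g) (S n :: v) z
| ev_mu : forall f v y,
    eval X f (y :: v) 0 ->
    (forall z, z < y -> exists w, w <> 0 /\ eval X f (z :: v) w) ->
    eval X (PMu f) v y.

Definition computable_in (X : nat -> Prop) (k : nat) (R : list nat -> Prop) : Prop :=
  exists e : prf, forall v, length v = k ->
    (R v -> eval X e v 1) /\ (~ R v -> eval X e v 0).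

(* Alternating quantifier prefix: qprefix m true R l =
   exists y_m, forall y_(m-1), ... R (y_1 :: ... :: y_m :: l). *)
Fixpoint qprefix (m : nat) (ex : bool) (R : list nat -> Prop) (l : list nat) : Prop :=
  match m with
  | 0 => R l
  | S m' => if ex then exists y, qprefix m' false R (y :: l)
            else forall y, qprefix m' true R (y :: l)
  end.

(* B is Sigma^0_(n+1)(X): B = { x | exists y1 forall y2 ... R(x, y1, ..., y_(n+1)) }
   with R an X-computable relation (Kleene normal form). *)
Definition Sigma0_rel (n : nat) (X : nat -> Prop) (B : nat -> Prop) : Prop :=
  exists R, computable_in X (n + 2) R /\
    forall x, B x <-> qprefix (n + 1) true R [x].

Definition Sigma0 (n : nat) (B : nat -> Prop) : Prop :=
  Sigma0_rel n (fun _ => False) B.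

Definition infinite_set (G : nat -> Prop) : Prop :=
  forall m, exists x, m <= x /\ G x.

(* Main.v *)
(** A class of sets is partition regular when it contains a part of each 2-partition of its
    members.  Starting with the infinite sets, one builds a decreasing tower of [n] partition
    regular classes and oracles [K_0, ..., K_n].  To climb one level over [K], choose a set whose
    columns split, whenever possible, the Boolean combinations of earlier columns with respect to
    pairs of Sigma^0_1(K) open classes; by the low basis theorem it costs no jump.  Then choose an
    ultrafilter [u] on these columns inside the current class.  The new class consists of the sets
    whose traces on members of [u] meet every Sigma^0_1(K) open class that contains [u]; "does [u]
    lie in the open class?" answers, in a way that is Pi^0_1 in the next oracle, whether the
    members of the new class can be extended to realise a Sigma_(m+1) statement.  As each level
    costs one jump, [B] is not enumerable in the last oracle.

    Mathias conditions with reservoirs in the last class then control all Sigma_m statements with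
    [m <= n].  For the Sigma_(n+1) definitions of [B] one uses compactness on 2-partitions of the
    reservoir: "every 2-partition has a part allowing an extension that forces [x] in" is
    enumerable in the reservoir, hence differs from [B] at some [x], and either an extension inside
    [A] or its complement, or a thinner reservoir, diagonalizes. *)

(* As [A] is arbitrary, no forcing question below the top level may mention it. A positive answer
   about a partition regular class holds for every member of the class, hence also for the part of a
   reservoir inside or outside [A] that is again a member; a negative answer thins by a set
   computable in the last oracle. So reservoirs need no complexity bound beyond not helping to
   enumerate [B].

   The splitting columns make the new class partition regular. Suppose both parts of a member fail,
   because of two open classes containing [u]. Take the open class of finite sets each of whose
   2-partitions has a part in one of the two. If it contains [u], the member has a finite subset in
   it, and one part does not fail. If not, some member of [u] can be split so as to avoid both
   classes; a column does so, [u] chooses a side, and one class does not contain [u].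

   The [n] levels use up the [n] jumps available, so no class answers the top question, and it is
   treated at a single [x]. There the sides are not symmetric: if the complement of [A] cannot
   diagonalize, this failure supplies the Sigma^0_1 event that makes [A] succeed. *)
Require Import Defs.
From Stdlib Require Import List Arith Lia Classical ClassicalEpsilon Cantor.
From Stdlib Require Import FunctionalExtensionality PropExtensionality.
Import ListNotations.

(** * Pairing and primitive recursive programs *)

Definition pr (x y : nat) : nat := Cantor.to_nat (x, y).
Definition p1 (z : nat) : nat := fst (Cantor.of_nat z).
Definition p2 (z : nat) : nat := snd (Cantor.of_nat z).

Lemma p1_pr x y : p1 (pr x y) = x.
Proof. unfold p1, pr. now rewrite Cantor.cancel_of_to. Qed.

Lemma p2_pr x y : p2 (pr x y) = y.
Proof. unfold p2, pr. now rewrite Cantor.cancel_of_to. Qed.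

Lemma pr_p z : pr (p1 z) (p2 z) = z.
Proof. unfold p1, p2, pr. rewrite <- surjective_pairing. apply Cantor.cancel_to_of. Qed.

Lemma pr_inj x y x' y' : pr x y = pr x' y' -> x = x' /\ y = y'.
Proof.
  intros H. split.
  - rewrite <- (p1_pr x y), H. apply p1_pr.
  - rewrite <- (p2_pr x y), H. apply p2_pr.
Qed.

(** Triangular numbers, in the recursive shape that [Cantor.to_nat] has for its diagonals; hence
    [pr_tri] holds by conversion. *)
Fixpoint tri (n : nat) : nat := match n with 0 => 0 | S m => S m + tri m end.

Lemma pr_tri x y : pr x y = y + tri (y + x).
Proof.
  reflexivity.
Qed.

Lemma le_pr_l x y : x <= pr x y.
Proof. generalize (Cantor.to_nat_non_decreasing x y). unfold pr. lia. Qed.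

Lemma le_pr_r x y : y <= pr x y.
Proof. generalize (Cantor.to_nat_non_decreasing x y). unfold pr. lia. Qed.

Lemma tri_mono a b : a <= b -> tri a <= tri b.
Proof. induction 1; cbn [tri]; lia. Qed.

Lemma p12_tri z : z = p2 z + tri (p2 z + p1 z).
Proof. rewrite <- pr_tri. now rewrite pr_p. Qed.

Global Opaque pr p1 p2.

Ltac spr := repeat first [rewrite p1_pr in * | rewrite p2_pr in *].

Notation O0 := (fun _ : nat => False).

Definition fn (f : nat -> nat) : Prop := exists e, forall x, eval O0 e [x] (f x).
Definition fn2 (f : nat -> nat -> nat) : Prop :=
  exists e, forall x y, eval O0 e [x; y] (f x y).

Lemma fn_ext f g : (forall x, f x = g x) -> fn f -> fn g.
Proof. intros H [e He]. exists e. intros x. now rewrite <- H. Qed.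

Lemma fn_id : fn (fun x => x).
Proof. exists (PProj 0). intros x. apply (ev_proj O0 0 [x]). Qed.

Lemma fn_const c : fn (fun _ => c).
Proof.
  induction c as [|c [e He]].
  - exists PZero. intros x. constructor.
  - exists (PComp PSucc [e]). intros x. econstructor.
    + constructor; [apply He | constructor].
    + apply (ev_succ O0 [c]).
Qed.

Lemma fn_S f : fn f -> fn (fun x => S (f x)).
Proof.
  intros [e He]. exists (PComp PSucc [e]). intros x. econstructor.
  - constructor; [apply He | constructor].
  - apply (ev_succ O0 [f x]).
Qed.

Lemma fn_comp f g : fn f -> fn g -> fn (fun x => f (g x)).
Proof.
  intros [e He] [d Hd]. exists (PComp e [d]). intros x. econstructor.
  - constructor; [apply Hd | constructor].
  - apply He.
Qed.

Lemma fn2_app op f g : fn2 op -> fn f -> fn g -> fn (fun x => op (f x) (g x)).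
Proof.
  intros [e He] [a Ha] [b Hb]. exists (PComp e [a; b]). intros x. econstructor.
  - constructor; [apply Ha | constructor; [apply Hb | constructor]].
  - apply He.
Qed.

Lemma fn2_swap op : fn2 op -> fn2 (fun x y => op y x).
Proof.
  intros [e He]. exists (PComp e [PProj 1; PProj 0]). intros x y. econstructor.
  - constructor; [apply (ev_proj O0 1 [x; y])|].
    constructor; [apply (ev_proj O0 0 [x; y]) | constructor].
  - apply He.
Qed.

Lemma fn2_rec (op : nat -> nat -> nat) a b :
  (forall y, eval O0 a [y] (op 0 y)) ->
  (forall n y, eval O0 b [n; op n y; y] (op (S n) y)) -> fn2 op.
Proof.
  intros Ha Hb. exists (PPrimRec a b). intros x y. induction x as [|x IH].
  - constructor. apply Ha.
  - econstructor; [apply IH | apply Hb].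
Qed.

Lemma fn2_add : fn2 Nat.add.
Proof.
  apply (fn2_rec _ (PProj 0) (PComp PSucc [PProj 1])).
  - intros y. apply (ev_proj O0 0 [y]).
  - intros n y. econstructor.
    + constructor; [apply (ev_proj O0 1 [n; n + y; y]) | constructor].
    + apply (ev_succ O0 [n + y]).
Qed.

Lemma fn2_mul : fn2 Nat.mul.
Proof.
  destruct fn2_add as [e He].
  apply (fn2_rec _ PZero (PComp e [PProj 2; PProj 1])).
  - intros y. constructor.
  - intros n y. econstructor.
    + constructor; [apply (ev_proj O0 2 [n; n * y; y])|].
      constructor; [apply (ev_proj O0 1 [n; n * y; y]) | constructor].
    + apply He.
Qed.

Lemma fn2_sub : fn2 Nat.sub.
Proof.
  assert (H : fn2 (fun n _ => pred n)).
  { apply (fn2_rec _ PZero (PProj 0)).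
    - intros y. constructor.
    - intros n y. apply (ev_proj O0 0 [n; pred n; y]). }
  destruct H as [e He].
  apply (fn2_swap (fun n y => y - n)).
  apply (fn2_rec _ (PProj 0) (PComp e [PProj 1; PProj 1])).
  - intros y. rewrite Nat.sub_0_r. apply (ev_proj O0 0 [y]).
  - intros n y. econstructor.
    + constructor; [apply (ev_proj O0 1 [n; y - n; y])|].
      constructor; [apply (ev_proj O0 1 [n; y - n; y]) | constructor].
    + rewrite Nat.sub_succ_r. apply He.
Qed.

Lemma fn_tri : fn tri.
Proof.
  destruct fn2_add as [e He].
  assert (H : fn2 (fun n _ => tri n)).
  { apply (fn2_rec _ PZero (PComp e [PComp PSucc [PProj 0]; PProj 1])).
    - intros y. constructor.
    - intros n y. econstructor.
      + constructor.
        * econstructor.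
          -- constructor; [apply (ev_proj O0 0 [n; tri n; y]) | constructor].
          -- apply (ev_succ O0 [n]).
        * constructor; [apply (ev_proj O0 1 [n; tri n; y]) | constructor].
      + apply He. }
  apply (fn2_app _ _ _ H fn_id fn_id).
Qed.

Lemma fn_pow2 : fn (fun n => 2 ^ n).
Proof.
  destruct fn2_add as [e He].
  assert (H : fn2 (fun n _ => 2 ^ n)).
  { apply (fn2_rec _ (PComp PSucc [PZero]) (PComp e [PProj 1; PProj 1])).
    - intros y. econstructor; [constructor; constructor|]. apply (ev_succ O0 [0]).
    - intros n y. econstructor.
      + constructor; [apply (ev_proj O0 1 [n; 2 ^ n; y])|].
        constructor; [apply (ev_proj O0 1 [n; 2 ^ n; y]) | constructor].
      + replace (2 ^ S n) with (2 ^ n + 2 ^ n) by (cbn; lia). apply He. }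
  apply (fn2_app _ _ _ H fn_id fn_id).
Qed.

Lemma fn_add f g : fn f -> fn g -> fn (fun x => f x + g x).
Proof. apply fn2_app, fn2_add. Qed.

Lemma fn_mul f g : fn f -> fn g -> fn (fun x => f x * g x).
Proof. apply fn2_app, fn2_mul. Qed.

Lemma fn_sub f g : fn f -> fn g -> fn (fun x => f x - g x).
Proof. apply fn2_app, fn2_sub. Qed.

Lemma fn_pow f : fn f -> fn (fun x => 2 ^ f x).
Proof. apply (fn_comp _ _ fn_pow2). Qed.

Lemma fn_pr f g : fn f -> fn g -> fn (fun x => pr (f x) (g x)).
Proof.
  intros Hf Hg. apply (fn_ext (fun x => g x + tri (g x + f x))).
  - intros x. now rewrite pr_tri.
  - apply fn_add; [assumption|]. apply (fn_comp tri); [apply fn_tri | now apply fn_add].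
Qed.

Lemma fn2_pr : fn2 pr.
Proof.
  destruct fn2_add as [e He]. destruct fn_tri as [d Hd].
  exists (PComp e [PProj 1; PComp d [PComp e [PProj 1; PProj 0]]]). intros x y.
  assert (H0 := ev_proj O0 0 [x; y]). assert (H1 := ev_proj O0 1 [x; y]).
  cbn in H0, H1. rewrite pr_tri. econstructor; [|apply He].
  constructor; [apply H1|]. constructor; [|constructor].
  econstructor; [|apply Hd]. constructor; [|constructor].
  econstructor; [|apply He]. repeat constructor; assumption.
Qed.

(** The sum of the coordinates numbers the diagonal of [z]: it is the least [s] with
    [z < tri (S s)], so the search stops when the truncated difference [S z - tri (S s)]
    vanishes. *)
Lemma fn_p12sum : fn (fun z => p2 z + p1 z).
Proof.
  assert (H : fn2 (fun s z => S z - tri (S s))).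
  { destruct fn2_sub as [e He].
    destruct (fn_comp tri S fn_tri (fn_S _ fn_id)) as [d Hd].
    exists (PComp e [PComp PSucc [PProj 1]; PComp d [PProj 0]]). intros s z.
    assert (H0 := ev_proj O0 0 [s; z]). assert (H1 := ev_proj O0 1 [s; z]).
    cbn [nth] in H0, H1. econstructor; [|apply He].
    constructor.
    - econstructor; [constructor; [apply H1 | constructor]|]. apply (ev_succ O0 [z]).
    - constructor; [|constructor]. econstructor; [|apply Hd].
      constructor; [apply H0 | constructor]. }
  destruct H as [e He]. exists (PMu e). intros z. constructor.
  - replace 0 with (S z - tri (S (p2 z + p1 z))); [apply He|].
    generalize (p12_tri z). cbn [tri]. lia.
  - intros s Hs. exists (S z - tri (S s)). split; [|apply He].
    generalize (p12_tri z) (tri_mono (S s) (p2 z + p1 z) Hs). lia.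
Qed.

Lemma fn_p2 f : fn f -> fn (fun x => p2 (f x)).
Proof.
  apply (fn_comp p2).
  apply (fn_ext (fun z => z - tri (p2 z + p1 z))).
  - intros z. generalize (p12_tri z). lia.
  - apply fn_sub; [apply fn_id|]. apply (fn_comp tri); [apply fn_tri | apply fn_p12sum].
Qed.

Lemma fn_p1 f : fn f -> fn (fun x => p1 (f x)).
Proof.
  apply (fn_comp p1).
  apply (fn_ext (fun z => (p2 z + p1 z) - p2 z)).
  - intros z. lia.
  - apply fn_sub; [apply fn_p12sum | apply fn_p2, fn_id].
Qed.

(** * Decidable and enumerable predicates *)

Definition dec (P : nat -> Prop) : Prop :=
  exists f, fn f /\ forall x, (P x /\ f x = 1) \/ (~ P x /\ f x = 0).

Lemma dec_ext P Q : (forall x, P x <-> Q x) -> dec P -> dec Q.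
Proof.
  intros H (f & Hf & Hd). exists f. split; [assumption|]. intros x.
  destruct (Hd x) as [[? ?]|[? ?]]; [left | right]; firstorder.
Qed.

Lemma dec_not P : dec P -> dec (fun x => ~ P x).
Proof.
  intros (f & Hf & Hd). exists (fun x => 1 - f x). split.
  - apply fn_sub; [apply fn_const | assumption].
  - intros x. destruct (Hd x) as [[? E]|[? E]]; rewrite E; [right | left]; tauto.
Qed.

Lemma dec_and P Q : dec P -> dec Q -> dec (fun x => P x /\ Q x).
Proof.
  intros (f & Hf & Hd) (g & Hg & He). exists (fun x => f x * g x). split.
  - now apply fn_mul.
  - intros x. destruct (Hd x) as [[? E]|[? E]], (He x) as [[? E']|[? E']];
      rewrite E, E'; cbn; tauto.
Qed.

Lemma dec_or P Q : dec P -> dec Q -> dec (fun x => P x \/ Q x).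
Proof.
  intros HP HQ. apply (dec_ext (fun x => ~ (~ P x /\ ~ Q x))).
  - intros x. tauto.
  - apply dec_not, dec_and; now apply dec_not.
Qed.

Lemma dec_eq f g : fn f -> fn g -> dec (fun x => f x = g x).
Proof.
  intros Hf Hg. exists (fun x => 1 - ((f x - g x) + (g x - f x))). split.
  - apply fn_sub; [apply fn_const|]. apply fn_add; now apply fn_sub.
  - intros x. lia.
Qed.

Lemma dec_lt f g : fn f -> fn g -> dec (fun x => f x < g x).
Proof.
  intros Hf Hg. exists (fun x => 1 - (1 - (g x - f x))). split.
  - apply fn_sub; [apply fn_const|]. apply fn_sub; [apply fn_const|]. now apply fn_sub.
  - intros x. lia.
Qed.

Lemma dec_sub P f : fn f -> dec P -> dec (fun x => P (f x)).
Proof.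
  intros Hf (g & Hg & Hd). exists (fun x => g (f x)). split.
  - now apply fn_comp.
  - intros x. apply Hd.
Qed.

Lemma dec_bex P b : dec (fun z => P (p1 z) (p2 z)) -> fn b ->
  dec (fun x => exists y, y < b x /\ P y x).
Proof.
  intros (f & Hf & Hd) Hb.
  (* On truth values [1 - (1 - a) * (1 - b)] is disjunction; the recursion collects the candidates
     below [n]. *)
  assert (Hop : fn2 (fix op n y := match n with 0 => 0
                       | S m => 1 - (1 - op m y) * (1 - f (pr m y)) end)).
  { destruct fn2_sub as [es Hs]. destruct fn2_mul as [em Hm].
    destruct fn2_pr as [ep Hp]. destruct Hf as [ef Hf].
    set (one := PComp PSucc [PZero]).
    assert (Hone : forall v, eval O0 one v 1).
    { intros v. econstructor; [constructor; constructor|]. apply (ev_succ O0 [0]). }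
    apply (fn2_rec _ PZero
      (PComp es [one; PComp em [PComp es [one; PProj 1];
                                PComp es [one; PComp ef [PComp ep [PProj 0; PProj 2]]]]])).
    - intros y. constructor.
    - intros n y. set (op := fix op n y := match n with 0 => 0
                       | S m => 1 - (1 - op m y) * (1 - f (pr m y)) end).
      assert (H0 := ev_proj O0 0 [n; op n y; y]).
      assert (H1 := ev_proj O0 1 [n; op n y; y]).
      assert (H2 := ev_proj O0 2 [n; op n y; y]). cbn [nth] in H0, H1, H2.
      econstructor; [|apply Hs].
      constructor; [apply Hone|]. constructor; [|constructor].
      econstructor; [|apply Hm].
      constructor.
      + econstructor; [|apply Hs]. constructor; [apply Hone|].
        constructor; [apply H1 | constructor].
      + constructor; [|constructor]. econstructor; [|apply Hs].
        constructor; [apply Hone|]. constructor; [|constructor].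
        econstructor; [|apply Hf]. constructor; [|constructor].
        econstructor; [|apply Hp]. repeat constructor; assumption. }
  set (op := fix op n y := match n with 0 => 0
                       | S m => 1 - (1 - op m y) * (1 - f (pr m y)) end) in Hop.
  exists (fun x => op (b x) x). split.
  - apply fn2_app; [assumption | assumption | apply fn_id].
  - intros x. generalize (b x) as n. induction n as [|n IH].
    + right. split; [|reflexivity]. intros (y & Hy & _). lia.
    + cbn [op]. specialize (Hd (pr n x)). rewrite p1_pr, p2_pr in Hd.
      destruct IH as [[(y & Hy & HP) E]|[HN E]]; fold op; rewrite E.
      * left. split; [exists y; split; [lia | assumption] | lia].
      * destruct Hd as [[HP E']|[HN' E']]; rewrite E'.
        -- left. split; [exists n; split; [lia | assumption] | lia].
        -- right. split; [|lia]. intros (y & Hy & HP).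
           destruct (Nat.eq_dec y n) as [->|]; [contradiction|].
           apply HN. exists y. split; [lia | assumption].
Qed.

Lemma dec_ball P b : dec (fun z => P (p1 z) (p2 z)) -> fn b ->
  dec (fun x => forall y, y < b x -> P y x).
Proof.
  intros HP Hb. apply (dec_ext (fun x => ~ exists y, y < b x /\ ~ P y x)).
  - intros x. split.
    + intros H y Hy. apply NNPP. intros H'. apply H. now exists y.
    + intros H (y & Hy & HN). auto.
  - apply dec_not. apply (dec_bex (fun y x => ~ P y x)); [now apply dec_not | assumption].
Qed.

(* Finite sets are coded by binary expansions. *)
Definition mem (i a : nat) : Prop := Nat.testbit a i = true.

(** Bit [i] is the parity of [a / 2 ^ i]; the bounds on [q] and [r] make [dec_bex] applicable. *)
Lemma mem_spec i a :
  mem i a <-> exists q, q < S a /\ exists r, r < 2 ^ i /\ a = (2 * q + 1) * 2 ^ i + r.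
Proof.
  unfold mem. rewrite Nat.testbit_true. assert (Hp : 2 ^ i <> 0) by (apply Nat.pow_nonzero; lia).
  split.
  - intros H. exists (a / 2 ^ i / 2). split.
    + apply Nat.lt_succ_r. etransitivity; [apply Nat.Div0.div_le_upper_bound with (q := a / 2 ^ i); lia|].
      apply Nat.Div0.div_le_upper_bound. nia.
    + exists (a mod 2 ^ i). split; [now apply Nat.mod_upper_bound|].
      assert (H1 := Nat.div_mod_eq a (2 ^ i)).
      assert (H2 := Nat.div_mod_eq (a / 2 ^ i) 2). rewrite H in H2. nia.
  - intros (q & _ & r & Hr & ->).
    rewrite Nat.div_add_l by assumption. rewrite (Nat.div_small r) by assumption.
    rewrite Nat.add_0_r, Nat.add_comm, Nat.mul_comm, Nat.Div0.mod_add. reflexivity.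
Qed.

Lemma mem_lt i a : mem i a -> i < a.
Proof.
  intros (q & _ & r & _ & ->)%mem_spec. assert (H := Nat.pow_gt_lin_r 2 i). nia.
Qed.

Lemma dec_mem f g : fn f -> fn g -> dec (fun x => mem (f x) (g x)).
Proof.
  intros Hf Hg.
  apply (dec_ext (fun x => exists q, q < S (g x) /\ exists r, r < 2 ^ f x /\
                           g x = (2 * q + 1) * 2 ^ f x + r)).
  { intros x. now rewrite mem_spec. }
  apply (dec_bex (fun q x => exists r, r < 2 ^ f x /\ g x = (2 * q + 1) * 2 ^ f x + r));
    [|now apply fn_S].
  assert (Hf' : fn (fun z => f (p2 z))) by (apply (fn_comp f); [|apply fn_p2, fn_id]; assumption).
  apply (dec_bex (fun r z => g (p2 z) = (2 * p1 z + 1) * 2 ^ f (p2 z) + r)); [|now apply fn_pow].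
  assert (Hz : fn (fun z => p2 (p2 z))) by (apply fn_p2, fn_p2, fn_id).
  apply dec_eq; [now apply (fn_comp g)|].
  apply fn_add; [|apply fn_p1, fn_id]. apply fn_mul.
  - apply fn_add; [|apply fn_const]. apply fn_mul; [apply fn_const|].
    apply fn_p1, fn_p2, fn_id.
  - apply fn_pow. now apply (fn_comp f).
Qed.

Definition ce (P : nat -> Prop) : Prop :=
  exists D, dec D /\ forall x, P x <-> exists w, D (pr w x).

Lemma ce_ext P Q : (forall x, P x <-> Q x) -> ce P -> ce Q.
Proof. intros H (D & HD & HP). exists D. split; [assumption|]. intros x. now rewrite <- H. Qed.

Lemma ce_dec P : dec P -> ce P.
Proof.
  intros H. exists (fun z => P (p2 z)). split.
  - apply dec_sub; [apply fn_p2, fn_id | assumption].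
  - intros x. split.
    + intros HP. exists 0. now rewrite p2_pr.
    + intros [w Hw]. now rewrite p2_pr in Hw.
Qed.

Lemma ce_sub P f : fn f -> ce P -> ce (fun x => P (f x)).
Proof.
  intros Hf (D & HD & HP). exists (fun z => D (pr (p1 z) (f (p2 z)))). split.
  - apply (dec_sub D); [|assumption].
    apply fn_pr; [apply fn_p1, fn_id | apply (fn_comp f); [assumption | apply fn_p2, fn_id]].
  - intros x. rewrite HP. split; intros [w Hw]; exists w; rewrite ?p1_pr, ?p2_pr in *; assumption.
Qed.

Lemma ce_and P Q : ce P -> ce Q -> ce (fun x => P x /\ Q x).
Proof.
  intros (D & HD & HP) (E & HE & HQ).
  exists (fun z => D (pr (p1 (p1 z)) (p2 z)) /\ E (pr (p2 (p1 z)) (p2 z))). split.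
  - apply dec_and; (apply dec_sub; [|assumption]); apply fn_pr;
      repeat first [apply fn_p1 | apply fn_p2 | apply fn_id].
  - intros x. rewrite HP, HQ. split.
    + intros [[a Ha] [b Hb]]. exists (pr a b). now spr.
    + intros [w [Ha Hb]]. rewrite !p1_pr, !p2_pr in *. split; eexists; eassumption.
Qed.

Lemma ce_or P Q : ce P -> ce Q -> ce (fun x => P x \/ Q x).
Proof.
  intros (D & HD & HP) (E & HE & HQ). exists (fun z => D z \/ E z). split.
  - now apply dec_or.
  - intros x. rewrite HP, HQ. firstorder.
Qed.

Lemma ce_ex P : ce (fun z => P (p1 z) (p2 z)) -> ce (fun x => exists y, P y x).
Proof.
  intros (D & HD & HP).
  exists (fun z => D (pr (p1 (p1 z)) (pr (p2 (p1 z)) (p2 z)))). split.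
  - apply dec_sub; [|assumption]. repeat apply fn_pr;
      repeat first [apply fn_p1 | apply fn_p2 | apply fn_id].
  - intros x. split.
    + intros [y Hy]. specialize (HP (pr y x)). rewrite p1_pr, p2_pr in HP.
      apply HP in Hy. destruct Hy as [w Hw]. exists (pr w y). now spr.
    + intros [w Hw]. rewrite !p1_pr, !p2_pr in Hw. exists (p2 w).
      specialize (HP (pr (p2 w) x)). rewrite p1_pr, p2_pr in HP. apply HP. now exists (p1 w).
Qed.

(** Bounded collection, by the maximum of the witnesses. It moves existential quantifiers out of
    bounded universal ones and gives uniform levels in compactness arguments. *)
Lemma eventually_all (P : nat -> nat -> Prop) n :
  (forall y w w', P y w -> w <= w' -> P y w') ->
  (forall y, y < n -> exists w, P y w) -> exists w, forall y, y < n -> P y w.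
Proof.
  intros Hm. induction n as [|n IH]; intros H.
  - exists 0. intros y Hy. lia.
  - destruct IH as [w Hw]; [intros y Hy; apply H; lia|].
    destruct (H n) as [w' Hw']; [lia|]. exists (Nat.max w w'). intros y Hy.
    destruct (Nat.eq_dec y n) as [->|]; eapply Hm; [apply Hw' | lia | apply Hw; lia | lia].
Qed.

Lemma ce_ball P b : ce (fun z => P (p1 z) (p2 z)) -> fn b ->
  ce (fun x => forall y, y < b x -> P y x).
Proof.
  intros (D & HD & HP) Hb.
  exists (fun z => forall y, y < b (p2 z) -> exists w, w < S (p1 z) /\ D (pr w (pr y (p2 z)))).
  split.
  - apply (dec_ball (fun y z => exists w, w < S (p1 z) /\ D (pr w (pr y (p2 z))))).
    + apply (dec_bex (fun w t => D (pr w (pr (p1 t) (p2 (p2 t)))))).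
      * apply dec_sub; [|assumption].
        repeat first [apply fn_pr | apply fn_p1 | apply fn_p2 | apply fn_id].
      * apply fn_S, fn_p1, fn_p2, fn_id.
    + apply (fn_comp b); [assumption | apply fn_p2, fn_id].
  - intros x. split.
    + intros H.
      destruct (eventually_all (fun y w => exists w', w' < S w /\ D (pr w' (pr y x))) (b x))
        as [w Hw].
      * intros y w w' (v & Hv & Hd) Hle. exists v. split; [lia | assumption].
      * intros y Hy. specialize (HP (pr y x)). rewrite p1_pr, p2_pr in HP.
        destruct (proj1 HP (H y Hy)) as [w Hw]. exists w, w. split; [lia | assumption].
      * exists w. rewrite p1_pr, p2_pr. assumption.
    + intros [w Hw] y Hy. rewrite p1_pr, p2_pr in Hw. destruct (Hw y Hy) as (v & _ & Hv).
      specialize (HP (pr y x)). rewrite p1_pr, p2_pr in HP. apply HP. now exists v.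
Qed.

(** * Finite sets and truncations of sets *)

Notation set := (nat -> Prop).

Lemma mem_setbit i a j : mem i (Nat.setbit a j) <-> i = j \/ mem i a.
Proof. unfold mem. rewrite Nat.setbit_iff. split; intros [H|H]; auto. Qed.

Lemma mem_lor i a b : mem i (Nat.lor a b) <-> mem i a \/ mem i b.
Proof. unfold mem. rewrite Nat.lor_spec. apply Bool.orb_true_iff. Qed.

Lemma mem_0 i : ~ mem i 0.
Proof. unfold mem. now rewrite Nat.bits_0. Qed.

Lemma mem_ext a b : (forall i, mem i a <-> mem i b) -> a = b.
Proof.
  intros H. apply Nat.bits_inj. intros i. specialize (H i). unfold mem in H.
  destruct (Nat.testbit a i), (Nat.testbit b i); try reflexivity; [symmetry|]; tauto.
Qed.

Lemma mem_bound a N : (forall i, mem i a -> i < N) -> a < 2 ^ N.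
Proof.
  intros H. destruct (Nat.eq_dec a 0) as [->|Ha].
  - assert (2 ^ N <> 0) by (apply Nat.pow_nonzero; lia). lia.
  - apply Nat.log2_lt_pow2; [lia|]. apply H. now apply Nat.bit_log2.
Qed.

Lemma mem_lt_pow i a N : a < 2 ^ N -> mem i a -> i < N.
Proof.
  intros Ha (q & _ & r & _ & E)%mem_spec. apply (Nat.pow_lt_mono_r_iff 2); [lia|]. nia.
Qed.

(** The code of an arbitrary set cut off at [N]. Excluded middle makes this a function; it serves in
    existence proofs and is not claimed to be computable. *)
Fixpoint tr (X : set) (N : nat) : nat :=
  match N with
  | 0 => 0
  | S M => if excluded_middle_informative (X M) then Nat.setbit (tr X M) M else tr X M
  end.

Lemma mem_tr X N i : mem i (tr X N) <-> i < N /\ X i.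
Proof.
  induction N as [|N IH]; cbn [tr].
  - split; [intros H%mem_0; tauto | lia].
  - destruct (excluded_middle_informative (X N)) as [HX|HX].
    + rewrite mem_setbit, IH. split.
      * intros [->|[H1 H2]]; split; trivial; lia.
      * intros [H1 H2]. destruct (Nat.eq_dec i N); [tauto|]. right. split; [lia | tauto].
    + rewrite IH. split; intros [H1 H2]; split; trivial; [lia|].
      destruct (Nat.eq_dec i N) as [->|]; [contradiction | lia].
Qed.

Lemma tr_lt X N : tr X N < 2 ^ N.
Proof. apply mem_bound. intros i. rewrite mem_tr. tauto. Qed.

Global Opaque tr.

Notation compl X := (fun i : nat => ~ X i).

Lemma dec_le f g : fn f -> fn g -> dec (fun x => f x <= g x).
Proof.
  intros Hf Hg. apply (dec_ext (fun x => f x < S (g x))); [intros x; lia|].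
  apply dec_lt; [assumption | now apply fn_S].
Qed.

Lemma ce_ball_mem P b : ce (fun z => P (p1 z) (p2 z)) -> fn b ->
  ce (fun x => forall y, mem y (b x) -> P y x).
Proof.
  intros HP Hb. apply (ce_ext (fun x => forall y, y < b x -> ~ mem y (b x) \/ P y x)).
  - intros x. split.
    + intros H y Hy. destruct (H y (mem_lt _ _ Hy)); tauto.
    + intros H y _. destruct (classic (mem y (b x))); auto.
  - apply (ce_ball (fun y x => ~ mem y (b x) \/ P y x)); [|assumption].
    apply ce_or; [|assumption]. apply ce_dec, dec_not, dec_mem; [apply fn_p1, fn_id|].
    apply (fn_comp b); [assumption | apply fn_p2, fn_id].
Qed.

(** * Automation for computability, and enumerability of derivations *)

Ltac fn_tac :=
  lazymatch goal with
  | |- fn (fun x => x) => apply fn_id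
  | |- fn (pr ?c) => apply (fn_pr (fun _ => c) (fun x => x)); fn_tac
  | |- fn S => apply (fn_S (fun x => x)), fn_id
  | |- fn p1 => apply (fn_p1 (fun x => x)), fn_id
  | |- fn p2 => apply (fn_p2 (fun x => x)), fn_id
  | |- fn (fun _ => ?c) => apply fn_const
  | |- fn (fun x => S (@?f x)) => apply (fn_S f); fn_tac
  | |- fn (fun x => pr (@?f x) (@?g x)) => apply (fn_pr f g); fn_tac
  | |- fn (fun x => @?f x + @?g x) => apply (fn_add f g); fn_tac
  | |- fn (fun x => @?f x * @?g x) => apply (fn_mul f g); fn_tac
  | |- fn (fun x => @?f x - @?g x) => apply (fn_sub f g); fn_tac
  | |- fn (fun x => 2 ^ (@?f x)) => apply (fn_pow f); fn_tac
  | |- fn (fun x => p1 (@?f x)) => apply (fn_p1 f); fn_tac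
  | |- fn (fun x => p2 (@?f x)) => apply (fn_p2 f); fn_tac
  | H : fn ?f |- fn ?f => exact H
  | H : fn ?f |- fn (fun x => ?f (@?g x)) => apply (fn_comp f g); [exact H | fn_tac]
  end.

Ltac ce_tac :=
  cbv beta;
  lazymatch goal with
  | |- ce (fun x => @?P x /\ @?Q x) => apply (ce_and P Q); ce_tac
  | |- ce (fun x => @?P x \/ @?Q x) => apply (ce_or P Q); ce_tac
  | |- ce (fun x => exists y, @?P x y) => apply (ce_ex (fun y x => P x y)); ce_tac
  | |- ce (fun x => forall y, y < @?b x -> @?P x y) =>
      apply (ce_ball (fun y x => P x y) b); [ce_tac | fn_tac]
  | |- ce (fun x => forall y, mem y (@?b x) -> @?P x y) =>
      apply (ce_ball_mem (fun y x => P x y) b); [ce_tac | fn_tac]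
  | |- ce (fun x => @eq nat (@?f x) (@?g x)) => apply ce_dec, (dec_eq f g); fn_tac
  | |- ce (fun x => @?f x < @?g x) => apply ce_dec, (dec_lt f g); fn_tac
  | |- ce (fun x => @?f x <= @?g x) => apply ce_dec, (dec_le f g); fn_tac
  | |- ce (fun x => mem (@?f x) (@?g x)) => apply ce_dec, (dec_mem f g); fn_tac
  | |- ce (fun x => ~ @eq nat (@?f x) (@?g x)) => apply ce_dec, dec_not, (dec_eq f g); fn_tac
  | |- ce (fun x => ~ (@?f x < @?g x)) => apply ce_dec, dec_not, (dec_lt f g); fn_tac
  | |- ce (fun x => ~ mem (@?f x) (@?g x)) => apply ce_dec, dec_not, (dec_mem f g); fn_tac
  | H : ce ?P |- ce (fun x => ?P (@?f x)) => apply (ce_sub P f); [fn_tac | exact H]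
  | |- _ => idtac
  end.

(** Every rule has two premises; a rule with a single premise repeats it. The parameter [c] will
    carry the oracle information. *)
Inductive der (Ax : nat -> Prop) (Rule : nat -> nat -> nat -> nat -> Prop) (c : nat)
  : nat -> Prop :=
| der_ax n : Ax n -> der Ax Rule c n
| der_rule n p q : Rule c n p q -> der Ax Rule c p -> der Ax Rule c q -> der Ax Rule c n.

(* A derivation is certified by a finite set of pairs (rank, fact); ranks keep it well founded. *)
Definition cert (Ax : nat -> Prop) (Rule : nat -> nat -> nat -> nat -> Prop) (c s : nat) : Prop :=
  forall z, mem z s -> Ax (p2 z) \/
    exists p q r r', r < p1 z /\ r' < p1 z /\ mem (pr r p) s /\ mem (pr r' q) s /\
                     Rule c (p2 z) p q.

Lemma der_cert Ax Rule c n :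
  der Ax Rule c n <-> exists s, cert Ax Rule c s /\ exists r, mem (pr r n) s.
Proof.
  split.
  - induction 1 as [n H|n p q H _ (s & Hs & r & Hr) _ (s' & Hs' & r' & Hr')].
    + exists (Nat.setbit 0 (pr 0 n)). split.
      * intros z [->|Hz]%mem_setbit; [spr; now left | now apply mem_0 in Hz].
      * exists 0. apply mem_setbit. now left.
    + exists (Nat.setbit (Nat.lor s s') (pr (S (r + r')) n)). split.
      * intros z [->|[Hz|Hz]%mem_lor]%mem_setbit.
        -- spr. right. exists p, q, r, r'. rewrite !mem_setbit, !mem_lor.
           repeat split; auto; lia.
        -- destruct (Hs z Hz) as [|(a & b & t & t' & H1)]; [now left|].
           right. exists a, b, t, t'. rewrite !mem_setbit, !mem_lor. tauto.
        -- destruct (Hs' z Hz) as [|(a & b & t & t' & H1)]; [now left|].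
           right. exists a, b, t, t'. rewrite !mem_setbit, !mem_lor. tauto.
      * exists (S (r + r')). apply mem_setbit. now left.
  - intros (s & Hs & r & Hr). revert n Hr.
    induction r as [r IH] using lt_wf_ind. intros n Hr.
    destruct (Hs _ Hr) as [H|(p & q & t & t' & H1 & H2 & H3 & H4 & H5)]; spr.
    + now apply der_ax.
    + apply (der_rule _ _ _ _ p q); [assumption | apply (IH t) | apply (IH t')]; assumption.
Qed.

Lemma ce_der Ax Rule : ce Ax ->
  ce (fun z => Rule (p1 z) (p1 (p2 z)) (p1 (p2 (p2 z))) (p2 (p2 (p2 z)))) ->
  ce (fun z => der Ax Rule (p1 z) (p2 z)).
Proof.
  intros HA HR.
  apply (ce_ext (fun z => exists s, cert Ax Rule (p1 z) s /\ exists r, mem (pr r (p2 z)) s)).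
  { intros z. symmetry. apply der_cert. }
  unfold cert. ce_tac.
  eapply ce_ext; [|refine (ce_sub _ (fun z => pr _ (pr _ (pr _ _))) _ HR)].
  - intros z. cbv beta. spr. reflexivity.
  - fn_tac.
Qed.

(** * Arithmetization of evaluation with finite oracle information *)

Fixpoint cl (l : list nat) : nat :=
  match l with [] => 0 | a :: l' => S (pr a (cl l')) end.

Fixpoint cp (e : prf) : nat :=
  match e with
  | PZero => pr 0 0
  | PSucc => pr 1 0
  | PProj i => pr 2 i
  | POracle => pr 3 0
  | PComp f gs => pr 4 (pr (cp f) (cl (map cp gs)))
  | PPrimRec f g => pr 5 (pr (cp f) (cp g))
  | PMu f => pr 6 (cp f)
  end.

(** The kinds of facts in a derivation. List lookup, evaluation of argument lists and the failed
    part of a search are facts of their own, so that two premises per rule suffice. *)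
Definition Fnth i v x := pr 0 (pr i (pr v x)).
Definition Fev e v z := pr 1 (pr e (pr v z)).
Definition Fevs gs v ys := pr 2 (pr gs (pr v ys)).
(* [f (z :: v)] is defined and nonzero for all [z < y]. *)
Definition Fmu f v y := pr 3 (pr f (pr v y)).

Definition ev_ax (n : nat) : Prop :=
  (* Lookup in the empty list gives [0], the default value of [nth]. *)
  (exists i, n = Fnth i 0 0) \/
  (exists a v, n = Fnth 0 (S (pr a v)) a) \/
  (exists v, n = Fev (pr 0 0) v 0) \/
  (exists v, n = Fevs 0 v 0) \/
  (exists f v, n = Fmu f v 0).

(* [c] codes a pair of finite sets of positive and negative oracle information. *)
Definition ev_rule (c n p q : nat) : Prop :=
  (exists i a v x, n = Fnth (S i) (S (pr a v)) x /\ p = Fnth i v x /\ q = Fnth i v x) \/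
  (exists v x, n = Fev (pr 1 0) v (S x) /\ p = Fnth 0 v x /\ q = Fnth 0 v x) \/
  (exists i v x, n = Fev (pr 2 i) v x /\ p = Fnth i v x /\ q = Fnth i v x) \/
  (exists v x, n = Fev (pr 3 0) v 1 /\ p = Fnth 0 v x /\ q = Fnth 0 v x /\ mem x (p1 c)) \/
  (exists v x, n = Fev (pr 3 0) v 0 /\ p = Fnth 0 v x /\ q = Fnth 0 v x /\ mem x (p2 c)) \/
  (exists f gs v ys z, n = Fev (pr 4 (pr f gs)) v z /\ p = Fevs gs v ys /\ q = Fev f ys z) \/
  (exists f g v z, n = Fev (pr 5 (pr f g)) (S (pr 0 v)) z /\ p = Fev f v z /\ q = Fev f v z) \/
  (exists f g k v r z, n = Fev (pr 5 (pr f g)) (S (pr (S k) v)) z /\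
     p = Fev (pr 5 (pr f g)) (S (pr k v)) r /\ q = Fev g (S (pr k (S (pr r v)))) z) \/
  (exists f v y, n = Fev (pr 6 f) v y /\ p = Fev f (S (pr y v)) 0 /\ q = Fmu f v y) \/
  (exists g gs v y ys, n = Fevs (S (pr g gs)) v (S (pr y ys)) /\
     p = Fev g v y /\ q = Fevs gs v ys) \/
  (exists f v y w, n = Fmu f v (S y) /\ p = Fmu f v y /\ q = Fev f (S (pr y v)) (S w)).

Definition Der (c n : nat) : Prop := der ev_ax ev_rule c n.

Lemma ce_Der : ce (fun z => Der (p1 z) (p2 z)).
Proof.
  apply ce_der.
  - unfold ev_ax, Fnth, Fev, Fevs, Fmu. ce_tac.
  - unfold ev_rule, Fnth, Fev, Fevs, Fmu. ce_tac.
Qed.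

Definition sub (p : nat) (X : set) : Prop := forall i, mem i p -> X i.
Definition dis (q : nat) (X : set) : Prop := forall i, mem i q -> ~ X i.

(** The generated principle has no hypothesis for the programs in the list of [PComp]. *)
Lemma prf_ind' (P : prf -> Prop) :
  P PZero -> P PSucc -> (forall i, P (PProj i)) -> P POracle ->
  (forall f gs, P f -> Forall P gs -> P (PComp f gs)) ->
  (forall f g, P f -> P g -> P (PPrimRec f g)) ->
  (forall f, P f -> P (PMu f)) -> forall e, P e.
Proof.
  intros H0 H1 H2 H3 H4 H5 H6. fix IH 1. intros [| |i| |f gs|f g|f].
  - apply H0.
  - apply H1.
  - apply H2.
  - apply H3.
  - apply H4; [apply IH|]. induction gs as [|g gs IHg]; constructor; [apply IH | apply IHg].
  - apply H5; apply IH.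
  - apply H6; apply IH.
Qed.

Lemma eval_fun X e : forall v z z', eval X e v z -> eval X e v z' -> z = z'.
Proof.
  induction e as [| |i| |f gs IHf IHg|f g IHf IHg|f IHf] using prf_ind';
    intros v z z' H H'.
  - inversion H; inversion H'; congruence.
  - inversion H; inversion H'; congruence.
  - inversion H; inversion H'; congruence.
  - inversion H; inversion H'; subst; congruence || contradiction.
  - inversion H as [| | | | |? ? ? ys ? HF HE| | |]; subst.
    inversion H' as [| | | | |? ? ? ys' ? HF' HE'| | |]; subst.
    assert (ys = ys') as <-; [|eapply IHf; eassumption].
    clear - IHg HF HF'. revert ys' HF'.
    induction HF as [|g y gs ys Hg HF IH]; intros ys' HF'; inversion HF'; subst; [reflexivity|].
    inversion IHg; subst. f_equal; eauto.
  - destruct v as [|k v]; [inversion H|]. revert z z' H H'.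
    induction k as [|k IH]; intros z z' H H'.
    + inversion H; inversion H'; subst; eauto.
    + inversion H as [| | | | | | |? ? ? ? r ? Hr Hz|]; subst.
      inversion H' as [| | | | | | |? ? ? ? r' ? Hr' Hz'|]; subst.
      assert (r = r') as <- by eauto. eauto.
  - inversion H as [| | | | | | | |? ? ? Hz Hl]; subst.
    inversion H' as [| | | | | | | |? ? ? Hz' Hl']; subst.
    destruct (lt_eq_lt_dec z z') as [[Hlt|]|Hlt]; [|assumption|].
    + destruct (Hl' z Hlt) as (w & Hw & He). elim Hw. eapply IHf; eassumption.
    + destruct (Hl z' Hlt) as (w & Hw & He). elim Hw. eapply IHf; eassumption.
Qed.

Lemma cl_inj_cons v a w : cl v = S (pr a w) -> exists v', v = a :: v' /\ w = cl v'.
Proof.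
  destruct v as [|b v]; cbn [cl]; [discriminate|]. intros H. injection H as H.
  apply pr_inj in H as [-> <-]. now exists v.
Qed.

Lemma nth_hd v : nth 0 v 0 = hd 0 v.
Proof. now destruct v. Qed.

Ltac pr_inv :=
  repeat match goal with
  | H : S _ = S _ |- _ => injection H as H
  | H : 0 = S _ |- _ => discriminate H
  | H : S _ = 0 |- _ => discriminate H
  | H : pr _ _ = pr _ _ |- _ => apply pr_inj in H as [? ?]
  | H : ?x = _ |- _ => is_var x; subst x
  | H : _ = ?x |- _ => is_var x; subst x
  end.

(** One induction for all four kinds of facts, as the rules mix them. Programs enter through [cp],
    since a number need not code a program. *)
Lemma Der_sound X c n : sub (p1 c) X -> dis (p2 c) X -> Der c n ->
  (forall i v x, n = Fnth i (cl v) x -> x = nth i v 0) /\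
  (forall e v z, n = Fev (cp e) (cl v) z -> eval X e v z) /\
  (forall gs v k, n = Fevs (cl (map cp gs)) (cl v) k ->
     exists ys, k = cl ys /\ Forall2 (fun g y => eval X g v y) gs ys) /\
  (forall f v y, n = Fmu (cp f) (cl v) y ->
     forall z, z < y -> exists w, w <> 0 /\ eval X f (z :: v) w).
Proof.
  intros Hp Hn. unfold Fnth, Fev, Fevs, Fmu.
  induction 1 as [n H|n p q H _ IHp _ IHq].
  - unfold ev_ax, Fnth, Fev, Fevs, Fmu in H.
    destruct H as [[i H]|[(a & v & H)|[(v & H)|[(v & H)|(f & v & H)]]]]; subst n;
      (split; [|split; [|split]]).
    all: intros; pr_inv.
    + destruct v as [|b v]; [|discriminate]. now destruct i0.
    + destruct v0 as [|b v0]; [discriminate|]. cbn [cl] in *. pr_inv. reflexivity.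
    + destruct e; cbn [cp] in *; pr_inv. constructor.
    + destruct gs as [|g gs]; [|discriminate]. exists []. split; [reflexivity | constructor].
    + lia.
  - destruct IHp as (P1 & P2 & P3 & P4), IHq as (Q1 & Q2 & Q3 & Q4).
    unfold ev_rule, Fnth, Fev, Fevs, Fmu in H.
    decompose [or ex and] H; clear H; subst n; (split; [|split; [|split]]).
    all: intros; pr_inv.
    + destruct v as [|b v]; [discriminate|]. cbn [cl] in *. pr_inv. cbn [nth]. now apply P1.
    + destruct e; cbn [cp] in *; pr_inv. rewrite (P1 0 v x0), nth_hd by reflexivity. constructor.
    + destruct e; cbn [cp] in *; pr_inv. rewrite (P1 i v z) by reflexivity. constructor.
    + destruct e; cbn [cp] in *; pr_inv. constructor.
      rewrite <- nth_hd, <- (P1 0 v x0) by reflexivity. now apply Hp.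
    + destruct e; cbn [cp] in *; pr_inv. constructor.
      rewrite <- nth_hd, <- (P1 0 v x0) by reflexivity. now apply Hn.
    + destruct e; cbn [cp] in *; pr_inv.
      destruct (P3 gs v _ eq_refl) as (ys & -> & HF).
      econstructor; [eassumption|]. now apply Q2.
    + destruct e; cbn [cp] in *; pr_inv.
      match goal with H : S (pr _ _) = cl _ |- _ =>
        symmetry in H; apply cl_inj_cons in H as (v' & -> & ->) end. constructor. now apply P2.
    + destruct e; cbn [cp] in *; pr_inv.
      match goal with H : S (pr _ _) = cl _ |- _ =>
        symmetry in H; apply cl_inj_cons in H as (v' & -> & ->) end.
      econstructor; [now apply (P2 (PPrimRec e1 e2) (_ :: v')) | now apply (Q2 e2 (_ :: _ :: v'))].
    + destruct e; cbn [cp] in *; pr_inv. constructor.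
      * now apply (P2 e (z :: v)).
      * now apply Q4.
    + destruct gs as [|g gs]; cbn [map cl] in *; [discriminate|]. pr_inv.
      destruct (Q3 gs v _ eq_refl) as (ys & -> & HF). eexists (_ :: ys).
      split; [reflexivity|]. constructor; [now apply P2 | assumption].
    + destruct (Nat.eq_dec z x1) as [->|].
      * exists (S x2). split; [discriminate|]. now apply (Q2 f (x1 :: v)).
      * apply (P4 f v x1); [reflexivity | lia].
Qed.

Lemma Der_mono c c' n :
  (forall i, mem i (p1 c) -> mem i (p1 c')) -> (forall i, mem i (p2 c) -> mem i (p2 c')) ->
  Der c n -> Der c' n.
Proof.
  intros H1 H2. induction 1 as [n H|n p q H _ IHp _ IHq].
  - now apply der_ax.
  - apply (der_rule _ _ _ _ p q); [|assumption..].
    unfold ev_rule in *.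
    decompose [or] H; clear H; try tauto.
    + right; right; right; left. firstorder.
    + right; right; right; right; left. firstorder.
Qed.

(** Information, not an infimum: what the first [N] bits of [X] tell, positively and negatively. *)
Definition inf (X : set) (N : nat) : nat := pr (tr X N) (tr (compl X) N).

Lemma Der_inf_mono X N M n : N <= M -> Der (inf X N) n -> Der (inf X M) n.
Proof.
  intros H. apply Der_mono; unfold inf; spr; intros i; rewrite !mem_tr; split; lia || tauto.
Qed.

Lemma Der_nth c i v : Der c (Fnth i (cl v) (nth i v 0)).
Proof.
  revert v. induction i as [|i IH]; intros [|a v]; cbn [nth cl].
  - apply der_ax. left. eauto.
  - apply der_ax. right; left. eauto.
  - apply der_ax. left. eauto.
  - eapply der_rule; [left; exists i, a, (cl v), (nth i v 0); eauto | apply IH | apply IH].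
Qed.

Lemma Der_complete X e : forall v z, eval X e v z ->
  exists N, Der (inf X N) (Fev (cp e) (cl v) z).
Proof.
  induction e as [| |i| |f gs IHf IHg|f g IHf IHg|f IHf] using prf_ind';
    intros v z H.
  - inversion H; subst. exists 0. apply der_ax. right; right; left. eauto.
  - inversion H; subst. exists 0. rewrite <- nth_hd.
    eapply der_rule; [right; left; exists (cl v), (nth 0 v 0); eauto | apply Der_nth..].
  - inversion H; subst. exists 0.
    eapply der_rule; [do 2 right; left; exists i, (cl v), (nth i v 0); eauto | apply Der_nth..].
  - inversion H as [| | |? Hx|? Hx| | | |]; subst; rewrite <- nth_hd in Hx; exists (S (nth 0 v 0)).
    + eapply der_rule; [do 3 right; left; exists (cl v), (nth 0 v 0) | apply Der_nth..].
      repeat split. unfold inf. spr. apply mem_tr. split; [lia | assumption].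
    + eapply der_rule; [do 4 right; left; exists (cl v), (nth 0 v 0) | apply Der_nth..].
      repeat split. unfold inf. spr. apply mem_tr. split; [lia | assumption].
  - inversion H as [| | | | |? ? ? ys ? HF HE| | |]; subst.
    destruct (IHf _ _ HE) as [N HN].
    assert (HM : exists M, Der (inf X M) (Fevs (cl (map cp gs)) (cl v) (cl ys))).
    { clear - IHg HF. induction HF as [|g y gs ys Hg HF IH]; cbn [map cl].
      - exists 0. apply der_ax. do 3 right; left. eauto.
      - inversion IHg as [|? ? H1 H2]; subst. destruct (IH H2) as [M HM].
        destruct (H1 _ _ Hg) as [N HN]. exists (Nat.max N M).
        eapply der_rule; [do 9 right; left; exists (cp g), (cl (map cp gs)), (cl v), y, (cl ys); eauto
          | eapply Der_inf_mono; [|apply HN]; lia | eapply Der_inf_mono; [|apply HM]; lia]. }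
    destruct HM as [M HM]. exists (Nat.max N M). cbn [cp].
    eapply der_rule; [do 5 right; left; exists (cp f), (cl (map cp gs)), (cl v), (cl ys), z; eauto
      | eapply Der_inf_mono; [|apply HM]; lia | eapply Der_inf_mono; [|apply HN]; lia].
  - destruct v as [|k v]; [inversion H|]. revert z H. cbn [cp cl].
    induction k as [|k IH]; intros z H.
    + inversion H as [| | | | | |? ? ? ? Hz| |]; subst. destruct (IHf _ _ Hz) as [N HN]. exists N.
      eapply der_rule; [do 6 right; left; exists (cp f), (cp g), (cl v), z; eauto | apply HN..].
    + inversion H as [| | | | | | |? ? ? ? r ? Hr Hz|]; subst.
      destruct (IH _ Hr) as [N HN]. destruct (IHg _ _ Hz) as [M HM]. exists (Nat.max N M).
      eapply der_rule; [do 7 right; left; exists (cp f), (cp g), k, (cl v), r, z; eauto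
        | eapply Der_inf_mono; [|apply HN]; lia | eapply Der_inf_mono; [|apply HM]; lia].
  - inversion H as [| | | | | | | |? ? ? Hz Hl]; subst.
    destruct (IHf _ _ Hz) as [N HN].
    assert (HM : exists M, Der (inf X M) (Fmu (cp f) (cl v) z)).
    { clear - IHf Hl. induction z as [|z IH].
      - exists 0. apply der_ax. do 4 right. eauto.
      - destruct IH as [M HM]; [intros y Hy; apply Hl; lia|].
        destruct (Hl z) as ([|w] & Hw & He); [lia | contradiction |].
        destruct (IHf _ _ He) as [N HN]. exists (Nat.max N M).
        eapply der_rule; [do 10 right; exists (cp f), (cl v), z, w; eauto
          | eapply Der_inf_mono; [|apply HM]; lia | eapply Der_inf_mono; [|apply HN]; lia]. }
    destruct HM as [M HM]. exists (Nat.max N M). cbn [cp].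
    eapply der_rule; [do 8 right; left; exists (cp f), (cl v), z; eauto
      | eapply Der_inf_mono; [|apply HN]; lia | eapply Der_inf_mono; [|apply HM]; lia].
Qed.

Lemma sub_tr X N : sub (tr X N) X.
Proof. intros i. rewrite mem_tr. tauto. Qed.

Lemma dis_tr X N : dis (tr (compl X) N) X.
Proof. intros i. rewrite mem_tr. tauto. Qed.

(** The use principle: a halting computation consults finitely many oracle bits. *)
Lemma eval_Der X e v z : eval X e v z <->
  exists p q, sub p X /\ dis q X /\ Der (pr p q) (Fev (cp e) (cl v) z).
Proof.
  split.
  - intros [N HN]%Der_complete. exists (tr X N), (tr (compl X) N).
    auto using sub_tr, dis_tr.
  - intros (p & q & Hp & Hq & H). eapply Der_sound in H; [|spr; eassumption..].
    now apply H.
Qed.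

(* The enumerating program runs with the empty oracle, hence the empty positive information. *)
Definition enum (e z : nat) : Prop :=
  exists w q, Der (pr 0 q) (Fev e (S (pr (pr w z) 0)) 1).

Lemma ce_enum : ce (fun z => enum (p1 z) (p2 z)).
Proof.
  unfold enum, Fev. ce_tac.
  eapply ce_ext; [|refine (ce_sub _ (fun z => pr _ _) _ ce_Der)].
  - intros z. cbv beta. spr. reflexivity.
  - fn_tac.
Qed.

(** Enumeration theorem: [Der] acts as the universal machine, and [e] is the code of a decision
    procedure for the matrix. *)
Lemma ce_index P : ce P -> exists e, forall z, P z <-> enum e z.
Proof.
  intros (D & (f & (e & He) & Hd) & HP). exists (cp e). intros z. rewrite HP.
  unfold enum. split.
  - intros [w Hw]. exists w.
    assert (H : eval O0 e [pr w z] 1).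
    { destruct (Hd (pr w z)) as [[_ <-]|[? _]]; [apply He | contradiction]. }
    apply eval_Der in H as (p & q & Hp & Hq & H). exists q.
    (* Positive information about the empty oracle is empty, so its code is the [0] that [enum]
       prescribes. *)
    assert (p = 0) as ->; [|exact H].
    apply mem_ext. intros i. split; [intros Hi%Hp; contradiction | intros Hi%mem_0; contradiction].
  - intros (w & q & H). exists w.
    assert (H' : eval O0 e [pr w z] 1).
    { apply eval_Der. exists 0, q. split; [intros i Hi%mem_0; contradiction|].
      split; [intros i _ [] | assumption]. }
    destruct (Hd (pr w z)) as [[? _]|[_ E]]; [assumption|].
    assert (H2 := He (pr w z)). rewrite E in H2. discriminate (eval_fun _ _ _ _ _ H' H2).
Qed.

Lemma ce_enum_sub e z : fn e -> fn z -> ce (fun x => enum (e x) (z x)).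
Proof.
  intros He Hz. eapply ce_ext; [|apply (ce_sub _ (fun x => pr (e x) (z x)) (fn_pr _ _ He Hz) ce_enum)].
  intros x. cbv beta. spr. reflexivity.
Qed.

Lemma ce_Der_sub c n : fn c -> fn n -> ce (fun x => Der (c x) (n x)).
Proof.
  intros He Hz. eapply ce_ext; [|apply (ce_sub _ (fun x => pr (c x) (n x)) (fn_pr _ _ He Hz) ce_Der)].
  intros x. cbv beta. spr. reflexivity.
Qed.

(** * Relative enumerability and the jump *)

(* Uniformly Sigma^0_1 predicates of a set and a number: [<x, <p, q>>] in [W] says that the
   positive information [p] and the negative information [q] about the set suffice for [x]. *)
Definition reu (P : set -> nat -> Prop) : Prop :=
  exists W, ce W /\ forall X x, P X x <->
    exists p q, sub p X /\ dis q X /\ W (pr x (pr p q)).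

Lemma reu_ext P Q : (forall X x, P X x <-> Q X x) -> reu P -> reu Q.
Proof.
  intros H (W & HW & HP). exists W. split; [assumption|]. intros X x. now rewrite <- H.
Qed.

Definition fsub (a b : nat) : Prop := forall i, mem i a -> mem i b.

(** Closing [W] under larger information makes it monotone along the truncations of [X], so that
    several facts can be tested at one common [N]. *)
Lemma reu_norm P : reu P -> exists W, ce W /\
  (forall X x N M, N <= M -> W (pr x (inf X N)) -> W (pr x (inf X M))) /\
  (forall X x, P X x <-> exists N, W (pr x (inf X N))) /\
  (forall X x p q, sub p X -> dis q X -> W (pr x (pr p q)) -> P X x).
Proof.
  intros (W & HW & HP).
  exists (fun z => exists p q, fsub p (p1 (p2 z)) /\ fsub q (p2 (p2 z)) /\
                     W (pr (p1 z) (pr p q))).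
  split; [unfold fsub; ce_tac|]. unfold inf. split; [|split].
  - intros X x N M HNM (p & q & Hp & Hq & H). spr. exists p, q.
    split; [|split; [|assumption]]; intros i Hi.
    + apply Hp in Hi. rewrite mem_tr in *. split; [lia | tauto].
    + apply Hq in Hi. rewrite mem_tr in *. split; [lia | tauto].
  - intros X x. rewrite HP. split.
    + intros (p & q & Hp & Hq & H). exists (p + q), p, q. spr.
      split; [|split; [|assumption]]; intros i Hi; apply mem_tr.
      * split; [apply mem_lt in Hi; lia | auto].
      * split; [apply mem_lt in Hi; lia | auto].
    + intros (N & p & q & Hp & Hq & H). spr. exists p, q.
      split; [|split; [|assumption]]; intros i Hi.
      * apply Hp in Hi. rewrite mem_tr in Hi. tauto.
      * apply Hq in Hi. rewrite mem_tr in Hi. tauto.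
  - intros X x p q Hp Hq (p' & q' & Hp' & Hq' & H). spr. apply HP. exists p', q'.
    split; [|split; [|assumption]]; intros i Hi; auto.
Qed.

Lemma reu_inf P W : ce W -> (forall X x, P X x <-> exists N, W (pr x (inf X N))) ->
  (forall X x p q, sub p X -> dis q X -> W (pr x (pr p q)) -> P X x) -> reu P.
Proof.
  intros HW H1 H2. exists W. split; [assumption|]. intros X x. split.
  - intros [N HN]%H1. unfold inf in HN. exists (tr X N), (tr (compl X) N).
    auto using sub_tr, dis_tr.
  - intros (p & q & Hp & Hq & H). eauto.
Qed.

Lemma reu_ce P : ce P -> reu (fun _ x => P x).
Proof.
  intros H. exists (fun z => P (p1 z)). split; [ce_tac|].
  intros X x. split.
  - intros HP. exists 0, 0. spr. repeat split; [intros i Hi%mem_0..|]; tauto.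
  - intros (p & q & _ & _ & HP). now spr.
Qed.

Lemma reu_sub P f : fn f -> reu P -> reu (fun X x => P X (f x)).
Proof.
  intros Hf (W & HW & HP). exists (fun z => W (pr (f (p1 z)) (p2 z))). split.
  - apply (ce_sub W); [|assumption]. apply fn_pr; [|fn_tac].
    apply (fn_comp f); [assumption | fn_tac].
  - intros X x. rewrite HP. split; intros (p & q & H); exists p, q; spr; assumption.
Qed.

Lemma reu_and P Q : reu P -> reu Q -> reu (fun X x => P X x /\ Q X x).
Proof.
  intros (W & HW & Hm & HP & HP')%reu_norm (V & HV & Hm' & HQ & HQ')%reu_norm.
  apply (reu_inf _ (fun z => W z /\ V z)).
  - now apply ce_and.
  - intros X x. rewrite HP, HQ. split.
    + intros [[N HN] [M HM]]. exists (Nat.max N M). split.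
      * eapply Hm; [|apply HN]. lia.
      * eapply Hm'; [|apply HM]. lia.
    + intros [N [H1 H2]]. eauto.
  - intros X x p q Hp Hq [H1 H2]. eauto.
Qed.

Lemma reu_or P Q : reu P -> reu Q -> reu (fun X x => P X x \/ Q X x).
Proof.
  intros (W & HW & HP) (V & HV & HQ). exists (fun z => W z \/ V z). split.
  - now apply ce_or.
  - intros X x. rewrite HP, HQ. firstorder.
Qed.

Lemma reu_ex P : reu (fun X z => P X (p1 z) (p2 z)) -> reu (fun X x => exists y, P X y x).
Proof.
  intros (W & HW & HP). exists (fun z => exists y, W (pr (pr y (p1 z)) (p2 z))). split.
  - ce_tac.
  - intros X x. split.
    + intros [y Hy]. specialize (HP X (pr y x)). spr. apply HP in Hy.
      destruct Hy as (p & q & H). exists p, q. spr.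
      split; [|split]; [..|exists y]; tauto.
    + intros (p & q & Hp & Hq & y & H). spr. exists y. specialize (HP X (pr y x)). spr.
      apply HP. eauto.
Qed.

Lemma reu_ball P b : reu (fun X z => P X (p1 z) (p2 z)) -> fn b ->
  reu (fun X x => forall y, y < b x -> P X y x).
Proof.
  intros (W & HW & Hm & HP & HP')%reu_norm Hb.
  apply (reu_inf _ (fun z => forall y, y < b (p1 z) -> W (pr (pr y (p1 z)) (p2 z)))).
  - apply (ce_ball (fun y z => W (pr (pr y (p1 z)) (p2 z)))); [ce_tac|].
    apply (fn_comp b); [assumption | fn_tac].
  - intros X x. split.
    + intros H.
      destruct (eventually_all (fun y N => W (pr (pr y x) (inf X N))) (b x)) as [N HN].
      * intros y N M HN HNM. eauto.
      * intros y Hy. specialize (HP X (pr y x)). spr. apply HP. auto.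
      * exists N. now spr.
    + intros [N HN] y Hy. spr. specialize (HP X (pr y x)). spr. apply HP. eauto.
  - intros X x p q Hp Hq H y Hy. spr. specialize (HP' X (pr y x)). spr. eauto.
Qed.

Lemma reu_in f : fn f -> reu (fun X x => X (f x)).
Proof.
  intros Hf. exists (fun z => mem (f (p1 z)) (p1 (p2 z))). split.
  - apply ce_dec, dec_mem; [|fn_tac]. apply (fn_comp f); [assumption | fn_tac].
  - intros X x. split.
    + intros H. exists (Nat.setbit 0 (f x)), 0. spr.
      split; [|split; [intros i Hi%mem_0; tauto|]].
      * intros i [->|Hi%mem_0]%mem_setbit; tauto.
      * apply mem_setbit. now left.
    + intros (p & q & Hp & _ & H). spr. now apply Hp.
Qed.

Lemma reu_nin f : fn f -> reu (fun X x => ~ X (f x)).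
Proof.
  intros Hf. exists (fun z => mem (f (p1 z)) (p2 (p2 z))). split.
  - apply ce_dec, dec_mem; [|fn_tac]. apply (fn_comp f); [assumption | fn_tac].
  - intros X x. split.
    + intros H. exists 0, (Nat.setbit 0 (f x)). spr.
      split; [intros i Hi%mem_0; tauto|split].
      * intros i [->|Hi%mem_0]%mem_setbit; tauto.
      * apply mem_setbit. now left.
    + intros (p & q & _ & Hq & H). spr. now apply Hq.
Qed.

Lemma reu_ball_mem P b : reu (fun X z => P X (p1 z) (p2 z)) -> fn b ->
  reu (fun X x => forall y, mem y (b x) -> P X y x).
Proof.
  intros HP Hb. apply (reu_ext (fun X x => forall y, y < b x -> ~ mem y (b x) \/ P X y x)).
  - intros X x. split.
    + intros H y Hy. destruct (H y (mem_lt _ _ Hy)); tauto.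
    + intros H y _. destruct (classic (mem y (b x))); auto.
  - apply (reu_ball (fun X y x => ~ mem y (b x) \/ P X y x)); [|assumption].
    apply reu_or; [|assumption]. apply (reu_ce (fun z => ~ mem (p1 z) (b (p2 z)))).
    apply ce_dec, dec_not, dec_mem; [fn_tac|]. apply (fn_comp b); [assumption | fn_tac].
Qed.

Ltac reu_tac :=
  cbv beta;
  lazymatch goal with
  | |- reu (fun X x => @?P X x /\ @?Q X x) => apply (reu_and P Q); reu_tac
  | |- reu (fun X x => @?P X x \/ @?Q X x) => apply (reu_or P Q); reu_tac
  | |- reu (fun X x => exists y, @?P X x y) => apply (reu_ex (fun X y x => P X x y)); reu_tac
  | |- reu (fun X x => forall y, y < @?b x -> @?P X x y) =>
      apply (reu_ball (fun X y x => P X x y) b); [reu_tac | fn_tac]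
  | |- reu (fun X x => forall y, mem y (@?b x) -> @?P X x y) =>
      apply (reu_ball_mem (fun X y x => P X x y) b); [reu_tac | fn_tac]
  | |- reu (fun X x => X (@?f x)) => apply (reu_in f); fn_tac
  | |- reu (fun X x => ~ X (@?f x)) => apply (reu_nin f); fn_tac
  | H : reu ?P |- reu (fun X x => ?P X (@?f x)) => apply (reu_sub P f); [fn_tac | exact H]
  | |- reu (fun X x => @?P x) => apply (reu_ce P); ce_tac
  | |- _ => idtac
  end.

(** The two hypotheses on [F] say that it is a Turing functional. *)
Lemma reu_comp (F : set -> set) P :
  reu F -> reu (fun X i => ~ F X i) -> reu P -> reu (fun X => P (F X)).
Proof.
  intros H1 H2 (W & HW & HP).
  apply (reu_ext (fun X x => exists p q, (forall i, mem i p -> F X i) /\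
     (forall i, mem i q -> ~ F X i) /\ W (pr x (pr p q)))).
  - intros X x. symmetry. apply HP.
  - reu_tac. apply (reu_sub (fun X i => ~ F X i)); [fn_tac | assumption].
Qed.

(** The stage bounds the codes of the information used and of the step of the enumeration. All
    searches are then bounded, so both [D] and its complement are Sigma^0_1 uniformly in the set. *)
Lemma reu_stage P : reu P -> exists D : set -> nat -> nat -> Prop,
  reu (fun X z => D X (p1 z) (p2 z)) /\ reu (fun X z => ~ D X (p1 z) (p2 z)) /\
  (forall X w w' x, w <= w' -> D X w x -> D X w' x) /\
  (forall X x, P X x <-> exists w, D X w x).
Proof.
  intros (W & (D & HD & HW) & HP).
  assert (HD1 := ce_dec _ HD). assert (HD2 := ce_dec _ (dec_not _ HD)).
  exists (fun X w x => exists p q v, p < S w /\ q < S w /\ v < S w /\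
            (forall i, mem i p -> X i) /\ (forall i, mem i q -> ~ X i) /\
            D (pr v (pr x (pr p q)))).
  split; [reu_tac|split; [|split]].
  - apply (reu_ext (fun X z => forall p, p < S (p1 z) -> forall q, q < S (p1 z) ->
      forall v, v < S (p1 z) -> (exists i, mem i p /\ ~ X i) \/ (exists i, mem i q /\ X i) \/
        ~ D (pr v (pr (p2 z) (pr p q))))).
    + intros X z. split.
      * intros H (p & q & v & Hp & Hq & Hv & H1 & H2 & H3).
        destruct (H p Hp q Hq v Hv) as [(i & Hi & Hx)|[(i & Hi & Hx)|]]; firstorder.
      * intros H p Hp q Hq v Hv. apply NNPP. intros Hn. apply H. exists p, q, v.
        repeat split; trivial.
        -- intros i Hi. apply NNPP. intros Hx. apply Hn. left. eauto.
        -- intros i Hi Hx. apply Hn. right; left. eauto.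
        -- apply NNPP. tauto.
    + reu_tac. apply (ce_sub (fun z => ~ D z)); [fn_tac | assumption].
  - intros X w w' x Hw (p & q & v & Hp & Hq & Hv & H). exists p, q, v.
    repeat (split; [lia|]). assumption.
  - intros X x. rewrite HP. split.
    + intros (p & q & Hp & Hq & H). apply HW in H as [v Hv].
      exists (p + q + v), p, q, v. repeat (split; [lia|]). auto.
    + intros (w & p & q & v & _ & _ & _ & Hp & Hq & Hv). exists p, q.
      split; [assumption|split; [assumption|]]. apply HW. eauto.
Qed.

(** The universal Sigma^0_1 predicate on pairs of an index and an argument, that is, the Turing jump
    up to recoding. *)
Definition jump (X : set) (z : nat) : Prop :=
  exists p q, sub p X /\ dis q X /\ enum (p1 z) (pr (p2 z) (pr p q)).

Lemma reu_jump : reu jump.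
Proof.
  unfold jump, sub, dis. reu_tac. apply ce_enum_sub; fn_tac.
Qed.

Lemma reu_index P : reu P -> exists e, forall X x, P X x <-> jump X (pr e x).
Proof.
  intros (W & HW & HP). destruct (ce_index _ HW) as [e He]. exists e. intros X x.
  rewrite HP. unfold jump. spr. split; intros (p & q & H); exists p, q.
  - now rewrite <- He.
  - now rewrite He.
Qed.

(** * Enumerability and reducibility relative to a fixed oracle *)

Definition re (K : set) (P : nat -> Prop) : Prop :=
  exists P', reu P' /\ forall x, P x <-> P' K x.

Lemma re_reu K P : reu P -> re K (P K).
Proof. intros H. exists P. split; [assumption | tauto]. Qed.

Lemma re_ext K P Q : (forall x, P x <-> Q x) -> re K P -> re K Q.
Proof. intros H (P' & HP & E). exists P'. split; [assumption|]. intros x. now rewrite <- H. Qed.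

Lemma re_index K P : re K P -> exists e, forall x, P x <-> jump K (pr e x).
Proof.
  intros (P' & HP & E). destruct (reu_index _ HP) as [e He]. exists e. intros x.
  now rewrite E.
Qed.

Lemma re_jump K : re K (jump K).
Proof. apply re_reu, reu_jump. Qed.

Lemma re_ce K P : ce P -> re K P.
Proof. intros H. exists (fun _ => P). split; [now apply reu_ce | tauto]. Qed.

Lemma re_sub K P f : fn f -> re K P -> re K (fun x => P (f x)).
Proof.
  intros Hf (P' & HP & E). exists (fun X x => P' X (f x)). split; [now apply reu_sub|].
  intros x. apply E.
Qed.

Lemma re_and K P Q : re K P -> re K Q -> re K (fun x => P x /\ Q x).
Proof.
  intros (P' & HP & E) (Q' & HQ & E'). exists (fun X x => P' X x /\ Q' X x).
  split; [now apply reu_and|]. intros x. now rewrite E, E'.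
Qed.

Lemma re_or K P Q : re K P -> re K Q -> re K (fun x => P x \/ Q x).
Proof.
  intros (P' & HP & E) (Q' & HQ & E'). exists (fun X x => P' X x \/ Q' X x).
  split; [now apply reu_or|]. intros x. now rewrite E, E'.
Qed.

Lemma re_ex K P : re K (fun z => P (p1 z) (p2 z)) -> re K (fun x => exists y, P y x).
Proof.
  intros (P' & HP & E). exists (fun X x => exists y, P' X (pr y x)).
  split; [reu_tac|]. intros x.
  split; intros [y Hy]; exists y; specialize (E (pr y x)); spr; now apply E.
Qed.

Lemma re_ball K P b : re K (fun z => P (p1 z) (p2 z)) -> fn b ->
  re K (fun x => forall y, y < b x -> P y x).
Proof.
  intros (P' & HP & E) Hb. exists (fun X x => forall y, y < b x -> P' X (pr y x)).
  split; [apply (reu_ball (fun X y x => P' X (pr y x))); [reu_tac | assumption]|]. intros x.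
  split; intros H y Hy; specialize (E (pr y x)); spr; apply E; auto.
Qed.

Lemma re_ball_mem K P b : re K (fun z => P (p1 z) (p2 z)) -> fn b ->
  re K (fun x => forall y, mem y (b x) -> P y x).
Proof.
  intros (P' & HP & E) Hb. exists (fun X x => forall y, mem y (b x) -> P' X (pr y x)).
  split; [apply (reu_ball_mem (fun X y x => P' X (pr y x))); [reu_tac | assumption]|]. intros x.
  split; intros H y Hy; specialize (E (pr y x)); spr; apply E; auto.
Qed.

Lemma re_in K f : fn f -> re K (fun x => K (f x)).
Proof. intros H. apply (re_reu K (fun X x => X (f x))). now apply reu_in. Qed.

Lemma re_nin K f : fn f -> re K (fun x => ~ K (f x)).
Proof. intros H. apply (re_reu K (fun X x => ~ X (f x))). now apply reu_nin. Qed.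

Lemma re_sub2 K R f g : re K (fun z => R (p1 z) (p2 z)) -> fn f -> fn g ->
  re K (fun x => R (f x) (g x)).
Proof.
  intros H Hf Hg. eapply re_ext; [|apply (re_sub K _ (fun x => pr (f x) (g x)) (fn_pr _ _ Hf Hg) H)].
  intros x. cbv beta. spr. reflexivity.
Qed.

Ltac re_tac :=
  cbv beta;
  lazymatch goal with
  | |- re _ (fun x => @?P x /\ @?Q x) => apply (re_and _ P Q); re_tac
  | |- re _ (fun x => @?P x \/ @?Q x) => apply (re_or _ P Q); re_tac
  | |- re _ (fun x => exists y, @?P x y) => apply (re_ex _ (fun y x => P x y)); re_tac
  | |- re _ (fun x => forall y, y < @?b x -> @?P x y) =>
      apply (re_ball _ (fun y x => P x y) b); [re_tac | fn_tac]
  | |- re _ (fun x => forall y, mem y (@?b x) -> @?P x y) =>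
      apply (re_ball_mem _ (fun y x => P x y) b); [re_tac | fn_tac]
  | H : re ?K (fun z => ~ ?R (p1 z) (p2 z)) |- re ?K (fun x => ~ ?R (@?f x) (@?g x)) =>
      apply (re_sub2 K (fun x y => ~ R x y) f g); [exact H | fn_tac | fn_tac]
  | H : re ?K (fun z => ?R (p1 z) (p2 z)) |- re ?K (fun x => ?R (@?f x) (@?g x)) =>
      apply (re_sub2 K R f g); [exact H | fn_tac | fn_tac]
  | H : re ?K (fun x => ~ ?P x) |- re ?K (fun x => ~ ?P (@?f x)) =>
      apply (re_sub K (fun x => ~ P x) f); [fn_tac | exact H]
  | H : re ?K ?P |- re ?K (fun x => ?P (@?f x)) => apply (re_sub K P f); [fn_tac | exact H]
  | |- re ?K (fun x => ?K (@?f x)) => apply (re_in K f); fn_tac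
  | |- re ?K (fun x => ~ ?K (@?f x)) => apply (re_nin K f); fn_tac
  | |- re _ (fun x => @?P x) => try (apply (re_ce _ P); progress ce_tac)
  end.

(** Turing reducibility in its Delta^0_1 form. *)
Definition tle (X Y : set) : Prop := re Y X /\ re Y (compl X).

Lemma re_tle X Y P : tle X Y -> re X P -> re Y P.
Proof.
  intros [H1 H2] (P' & (W & HW & HP) & E).
  apply (re_ext _ (fun x => exists p q, (forall i, mem i p -> X i) /\
     (forall i, mem i q -> ~ X i) /\ W (pr x (pr p q)))).
  - intros x. rewrite E, HP. reflexivity.
  - re_tac.
Qed.

Lemma tle_refl X : tle X X.
Proof. split; [apply (re_in X (fun x => x)) | apply (re_nin X (fun x => x))]; fn_tac. Qed.

Lemma tle_trans X Y Z : tle X Y -> tle Y Z -> tle X Z.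
Proof. intros [H1 H2] H. split; eapply re_tle; eassumption. Qed.

Lemma re_tle_jump X P : re X P -> tle P (jump X).
Proof.
  intros [e He]%re_index. split.
  - apply (re_ext _ (fun x => jump X (pr e x))); [intros x; now rewrite He|]. apply re_in. fn_tac.
  - apply (re_ext _ (fun x => ~ jump X (pr e x))); [intros x; now rewrite He|]. apply re_nin. fn_tac.
Qed.

Lemma tle_jump X : tle X (jump X).
Proof. apply re_tle_jump, tle_refl. Qed.

Lemma jump_mono X Y : tle X Y -> tle (jump X) (jump Y).
Proof. intros H. apply re_tle_jump. apply (re_tle X); [assumption | apply re_jump]. Qed.

(** The extra jump is applied innermost, so that one jump can be absorbed into the oracle by
    conversion. *)
Fixpoint jumpn (n : nat) (X : set) : set :=
  match n with 0 => X | S m => jumpn m (jump X) end.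

Lemma jumpn_mono n X Y : tle X Y -> tle (jumpn n X) (jumpn n Y).
Proof.
  revert X Y. induction n as [|n IH]; intros X Y H; [assumption|]. apply IH, jump_mono, H.
Qed.

Definition join (K Y : set) (z : nat) : Prop :=
  (p1 z = 0 /\ K (p2 z)) \/ (p1 z <> 0 /\ Y (p2 z)).

Lemma join_0 K Y i : join K Y (pr 0 i) <-> K i.
Proof. unfold join. spr. intuition congruence. Qed.

Lemma join_1 K Y i : join K Y (pr 1 i) <-> Y i.
Proof. unfold join. spr. intuition congruence. Qed.

Lemma join_n K Y z : ~ join K Y z <-> (p1 z = 0 /\ ~ K (p2 z)) \/ (p1 z <> 0 /\ ~ Y (p2 z)).
Proof. unfold join. destruct (Nat.eq_dec (p1 z) 0); tauto. Qed.

Lemma tle_join_l K Y : tle K (join K Y).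
Proof.
  split.
  - apply (re_ext _ (fun x => join K Y (pr 0 x))); [intros x; apply join_0|]. apply re_in. fn_tac.
  - apply (re_ext _ (fun x => ~ join K Y (pr 0 x))); [intros x; now rewrite join_0|]. apply re_nin. fn_tac.
Qed.

Lemma tle_join_r K Y : tle Y (join K Y).
Proof.
  split.
  - apply (re_ext _ (fun x => join K Y (pr 1 x))); [intros x; apply join_1|]. apply re_in. fn_tac.
  - apply (re_ext _ (fun x => ~ join K Y (pr 1 x))); [intros x; now rewrite join_1|]. apply re_nin. fn_tac.
Qed.

Lemma join_tle K Y Z : tle K Z -> tle Y Z -> tle (join K Y) Z.
Proof.
  intros [H1 H2] [H3 H4]. split.
  - unfold join. re_tac.
  - apply (re_ext _ (fun z => (p1 z = 0 /\ ~ K (p2 z)) \/ (p1 z <> 0 /\ ~ Y (p2 z)))).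
    + intros z. now rewrite join_n.
    + re_tac.
Qed.

(** The information about [K] is verified inside [R], leaving only conditions on [Y]. Statements
    about the join thus become Sigma^0_1(K) sets of conditions, ready to be forbidden in a Pi^0_1
    class. *)
Lemma join_use K P : reu P -> exists R, re K R /\
  forall Y x, P (join K Y) x <-> exists p q, sub p Y /\ dis q Y /\ R (pr x (pr p q)).
Proof.
  intros (W & HW & HP).
  exists (fun z => exists a b,
    (forall i, mem i a -> (p1 i = 0 /\ K (p2 i)) \/ (p1 i <> 0 /\ mem (p2 i) (p1 (p2 z)))) /\
    (forall i, mem i b -> (p1 i = 0 /\ ~ K (p2 i)) \/ (p1 i <> 0 /\ mem (p2 i) (p2 (p2 z)))) /\
    W (pr (p1 z) (pr a b))).
  split; [re_tac|]. intros Y x. rewrite HP. split.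
  - intros (a & b & Ha & Hb & H). exists (tr Y (a + b)), (tr (compl Y) (a + b)).
    split; [apply sub_tr|]. split; [apply dis_tr|]. exists a, b. spr.
    assert (Hle : forall i, p2 i <= i).
    { intros i. rewrite <- (pr_p i) at 2. apply le_pr_r. }
    split; [|split; [|assumption]]; intros i Hi; assert (Hlt := mem_lt _ _ Hi);
      specialize (Hle i).
    + destruct (Ha i Hi) as [?|[? ?]]; [now left|]. right.
      rewrite mem_tr. repeat split; trivial. lia.
    + destruct (proj1 (join_n _ _ _) (Hb i Hi)) as [?|[? ?]]; [now left|]. right.
      rewrite mem_tr. repeat split; trivial. lia.
  - intros (p & q & Hp & Hq & a & b & Ha & Hb & H). spr. exists a, b.
    split; [|split; [|assumption]]; intros i Hi.
    + destruct (Ha i Hi) as [?|[? ?]]; [now left|]. right. auto.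
    + apply join_n. destruct (Hb i Hi) as [?|[? ?]]; [now left|]. right. auto.
Qed.

(** * Post's theorem *)

Fixpoint sigma_over (K : set) (n : nat) (P : nat -> Prop) : Prop :=
  match n with
  | 0 => re K P
  | S m => exists Q, sigma_over K m Q /\ forall x, P x <-> exists y, ~ Q (pr y x)
  end.

(** A Sigma^0_1 fact about the jump needs finite information [p] inside it and [q] outside it. Once
    a stage [u] bounds the enumeration of [p], what remains is co-enumerable in [K]. *)
Lemma sigma_over_jump K n P : sigma_over (jump K) n P -> sigma_over K (S n) P.
Proof.
  revert P. induction n as [|n IH]; intros P H.
  - destruct H as (P' & (W & (D & HD & HW) & HP) & E).
    destruct (reu_stage _ reu_jump) as (T & HT & HT' & Hmono & HJ).
    assert (HDn := ce_dec _ (dec_not _ HD)). assert (HJK := re_jump K).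
    assert (HTn : re K (fun z => ~ T K (p1 z) (p2 z))) by apply (re_reu K _ HT').
    exists (fun z => let p := p1 (p1 (p1 z)) in let q := p2 (p1 (p1 z)) in
              let w := p1 (p2 (p1 z)) in let u := p2 (p2 (p1 z)) in
              ~ D (pr w (pr (p2 z) (pr p q))) \/ (exists i, mem i p /\ ~ T K u i) \/
              (exists i, mem i q /\ jump K i)).
    split.
    + cbv zeta. cbn [sigma_over]. re_tac.
      apply re_ce. apply (ce_sub (fun z => ~ D z)); [fn_tac | assumption].
    + intros x. rewrite E, HP. split.
      * intros (p & q & Hp & Hq & H). apply HW in H as [w Hw].
        destruct (eventually_all (fun i u => mem i p -> T K u i) p) as [u Hu].
        -- intros i u u' Hu Hle Hi. eauto.
        -- intros i _. destruct (classic (mem i p)) as [Hi|Hi].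
           ++ destruct (proj1 (HJ K i) (Hp i Hi)) as [u Hu]. eauto.
           ++ exists 0. tauto.
        -- exists (pr (pr p q) (pr w u)). spr. intros [H|[(i & Hi & H)|(i & Hi & H)]].
           ++ tauto.
           ++ apply H, Hu; [now apply mem_lt | assumption].
           ++ now apply (Hq i).
      * intros [y Hy]. spr. exists (p1 (p1 y)), (p2 (p1 y)). split; [|split].
        -- intros i Hi. apply HJ. exists (p2 (p2 y)). apply NNPP. intros H. apply Hy.
           right; left. eauto.
        -- intros i Hi H. apply Hy. right; right. eauto.
        -- apply HW. exists (p1 (p2 y)). apply NNPP. tauto.
  - destruct H as (Q & HQ & E). exists Q. split; [now apply IH | assumption].
Qed.

Lemma re_jumpn_sigma_over n X B : re (jumpn n X) B -> sigma_over X n B.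
Proof. revert X. induction n as [|n IH]; intros X H; [assumption|]. now apply sigma_over_jump, IH. Qed.

Lemma re_O0_ce P : re O0 P -> ce P.
Proof.
  intros (P' & (W & HW & HP) & E).
  apply (ce_ext (fun x => exists q, W (pr x (pr 0 q)))); [|ce_tac].
  intros x. rewrite E, HP. split.
  - intros [q Hq]. exists 0, q. split; [intros i Hi%mem_0; tauto|]. split; [|assumption].
    intros i _ [].
  - intros (p & q & Hp & _ & H). exists q.
    assert (p = 0) as <-; [|exact H].
    apply mem_ext. intros i. split; [intros Hi%Hp | intros Hi%mem_0]; contradiction.
Qed.

Lemma qprefix_not m b R l : qprefix m (negb b) (fun l => ~ R l) l <-> ~ qprefix m b R l.
Proof.
  revert b l. induction m as [|m IH]; intros b l; cbn [qprefix]; [tauto|].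
  destruct b; cbn [negb].
  - split.
    + intros H [y Hy]. now apply (IH false (y :: l)).
    + intros H y. apply (IH false). intros Hy. apply H. now exists y.
  - split.
    + intros [y Hy] H. now apply (IH true (y :: l)).
    + intros H. apply NNPP. intros Hn. apply H. intros y. apply NNPP. intros Hy. apply Hn.
      exists y. now apply (IH true).
Qed.

(** Quantified variables are put in front of the list, so [g] may recode the parameters if it leaves
    a prefix of length [m] alone. *)
Lemma qprefix_map (g : list nat -> list nat) R m : forall b l l',
  (forall ys, length ys = m -> g (ys ++ l) = ys ++ l') ->
  (qprefix m b (fun l => R (g l)) l <-> qprefix m b R l').
Proof.
  induction m as [|m IH]; intros b l l' H; cbn [qprefix].
  - specialize (H [] eq_refl). cbn in H. now rewrite H.
  - assert (IH' : forall b y, qprefix m b (fun l => R (g l)) (y :: l) <-> qprefix m b R (y :: l')).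
    { intros b' y. apply IH. intros ys Hys. specialize (H (ys ++ [y])).
      rewrite <- !app_assoc in H. apply H. rewrite length_app. cbn. lia. }
    destruct b; split.
    + intros [y Hy]. exists y. now apply IH'.
    + intros [y Hy]. exists y. now apply IH'.
    + intros Hy y. now apply IH'.
    + intros Hy y. now apply IH'.
Qed.

Lemma map_nth_seq (ys t : list nat) k : length ys = k ->
  map (fun i => nth i (ys ++ t) 0) (seq 0 k) = ys.
Proof.
  intros <-. induction ys as [|y ys IH]; [reflexivity|].
  cbn [length seq map app nth]. f_equal. rewrite <- seq_shift, map_map. apply IH.
Qed.

Lemma sigma_over_Sigma0 n P : sigma_over O0 n P -> Sigma0 n P.
Proof.
  revert P. unfold Sigma0, Sigma0_rel. destruct fn2_pr as [ep Hep].
  induction n as [|n IH]; intros P H.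
  - apply re_O0_ce in H as (D & (f & (e & He) & Hf) & HP).
    exists (fun l => D (pr (nth 0 l 0) (nth 1 l 0))). split; [|intros x; apply HP].
    exists (PComp e [PComp ep [PProj 0; PProj 1]]). intros v _.
    assert (HE : eval O0 (PComp e [PComp ep [PProj 0; PProj 1]]) v
                   (f (pr (nth 0 v 0) (nth 1 v 0)))).
    { econstructor; [|apply He]. constructor; [|constructor]. econstructor; [|apply Hep].
      repeat constructor. }
    destruct (Hf (pr (nth 0 v 0) (nth 1 v 0))) as [[H E]|[H E]]; rewrite E in HE; tauto.
  - destruct H as (Q & HQ & E). apply IH in HQ as (R0 & (e & He) & HQ).
    (* Of the [n + 3] entries, the first [n + 1] are kept and the last two, [y] and [x], are merged
       into the argument [pr y x] of [Q]. *)
    set (g := fun l => map (fun i => nth i l 0) (seq 0 (n + 1)) ++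
                       [pr (nth (n + 1) l 0) (nth (n + 2) l 0)]).
    exists (fun l => ~ R0 (g l)). split.
    + destruct fn2_sub as [es Hes].
      set (c := PComp e (map PProj (seq 0 (n + 1)) ++ [PComp ep [PProj (n + 1); PProj (n + 2)]])).
      exists (PComp es [PComp PSucc [PZero]; c]). intros v Hv.
      assert (Hg : forall z, eval O0 e (g v) z -> eval O0 c v z).
      { intros z Hz. econstructor; [|apply Hz]. apply Forall2_app.
        - generalize (seq 0 (n + 1)) as s. induction s as [|i s IHs]; constructor; [constructor | assumption].
        - constructor; [|constructor]. econstructor; [|apply Hep]. repeat constructor. }
      assert (Hn : forall z, eval O0 c v z -> eval O0 (PComp es [PComp PSucc [PZero]; c]) v (1 - z)).
      { intros z Hz. econstructor; [|apply Hes]. constructor.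
        - econstructor; [constructor; constructor|]. apply (ev_succ O0 [0]).
        - constructor; [assumption | constructor]. }
      destruct (He (g v)) as [He1 He2].
      { unfold g. rewrite length_app, length_map, length_seq. cbn. lia. }
      split; intros H.
      * apply (Hn 0), Hg, He2, H.
      * apply (Hn 1), Hg, He1, NNPP, H.
    + intros x. rewrite E. cbn [Nat.add qprefix].
      assert (HH : forall y, qprefix (n + 1) false (fun l => ~ R0 (g l)) [y; x] <-> ~ Q (pr y x)).
      { intros y. rewrite HQ.
        rewrite (qprefix_not (n + 1) true (fun l => R0 (g l)) [y; x]).
        rewrite (qprefix_map g R0 (n + 1) true [y; x] [pr y x]); [reflexivity|].
        intros ys Hys. unfold g. rewrite map_nth_seq by assumption. f_equal. f_equal.
        f_equal; rewrite app_nth2 by lia; rewrite Hys.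
        - now replace (n + 1 - (n + 1)) with 0 by lia.
        - now replace (n + 2 - (n + 1)) with 1 by lia. }
      split; intros [y Hy]; exists y; now apply HH.
Qed.

Lemma re_jumpn_Sigma0 n B : re (jumpn n O0) B -> Sigma0 n B.
Proof. intros H. now apply sigma_over_Sigma0, re_jumpn_sigma_over. Qed.

(** * Basis theorems for Pi^0_1 classes *)

(** [R] enumerates the forbidden conditions, pairs of positive and negative information. *)
Definition pi_class (R : nat -> Prop) (Y : set) : Prop :=
  forall p q, sub p Y -> dis q Y -> ~ R (pr p q).

(** Emptiness in Sigma^0_1 form: at some level each string already contains a forbidden condition.
    That this captures emptiness is [empty_class_sound] and [compactness]. *)
Definition empty_class (R : nat -> Prop) : Prop :=
  exists l, forall a, a < 2 ^ l -> exists p q, (forall i, mem i p -> mem i a) /\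
    (forall i, mem i q -> i < l /\ ~ mem i a) /\ R (pr p q).

Lemma empty_class_sound R Y : empty_class R -> exists p q, sub p Y /\ dis q Y /\ R (pr p q).
Proof.
  intros [l H]. destruct (H (tr Y l) (tr_lt _ _)) as (p & q & Hp & Hq & HR).
  exists p, q. split; [|split; [|assumption]]; intros i Hi.
  - apply Hp in Hi. now apply mem_tr in Hi.
  - intros HY. apply Hq in Hi as [H1 H2]. apply H2, mem_tr. tauto.
Qed.

Lemma empty_class_mono (R R' : nat -> Prop) : (forall c, R c -> R' c) -> empty_class R -> empty_class R'.
Proof.
  intros HR [l H]. exists l. intros a Ha. destruct (H a Ha) as (p & q & H1 & H2 & H3).
  exists p, q. auto.
Qed.

Lemma re_empty_class H R : re H (fun z => R (p1 z) (p2 z)) -> re H (fun x => empty_class (R x)).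
Proof. intros HR. unfold empty_class. re_tac. Qed.

(** König's lemma: follow the leftmost path among strings extendible to all levels. *)
Lemma compactness R : ~ empty_class R -> exists Y, pi_class R Y.
Proof.
  intros HE.
  set (ok := fun m (b : set) => ~ exists p q, sub p b /\
               (forall i, mem i q -> i < m /\ ~ b i) /\ R (pr p q)).
  assert (Hok : forall m, exists b, ok m b).
  { intros m. apply NNPP. intros Hn. apply HE. exists m. intros a Ha. apply NNPP. intros H.
    apply Hn. exists (fun i => mem i a). intros (p & q & H1 & H2 & H3). apply H.
    exists p, q. auto. }
  (* Some set agrees with [a] below [l] and survives up to level [m], for each [m]; [pa] puts in a
     bit only if leaving it out destroys this. *)
  set (extends := fun l a => forall m, l <= m -> exists b, ok m b /\ forall i, i < l -> (b i <-> mem i a)).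
  assert (Hdown : forall m m' b, m <= m' -> ok m' b -> ok m b).
  { intros m m' b Hm Hb (p & q & H1 & H2 & H3). apply Hb. exists p, q.
    split; [assumption|]. split; [|assumption]. intros i Hi. apply H2 in Hi. split; [lia | tauto]. }
  set (pa := fix pa l := match l with
      | 0 => 0
      | S k => if excluded_middle_informative (extends (S k) (pa k)) then pa k
               else Nat.setbit (pa k) k end).
  assert (Hb : forall l i, mem i (pa l) -> i < l).
  { induction l as [|l IH]; cbn [pa]; intros i; [intros Hi%mem_0; tauto|].
    destruct (excluded_middle_informative _).
    - intros Hi%IH. lia.
    - intros [->|Hi%IH]%mem_setbit; lia. }
  assert (Hext : forall l, extends l (pa l)).
  { induction l as [|l IH].
    - intros m _. destruct (Hok m) as [b Hm]. exists b. split; [assumption | lia].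
    - cbn [pa]. destruct (excluded_middle_informative _) as [H|H]; [assumption|].
      apply not_all_ex_not in H as [m1 H]. apply imply_to_and in H as [Hm1 H].
      intros m Hm. destruct (IH (Nat.max m m1)) as (b & Hb1 & Hb2); [lia|].
      exists b. split; [eapply Hdown; [|apply Hb1]; lia|].
      intros i Hi. rewrite mem_setbit.
      destruct (Nat.eq_dec i l) as [->|]; [|rewrite Hb2 by lia; tauto].
      split; [tauto|]. intros _. apply NNPP. intros Hn. apply H. exists b.
      split; [eapply Hdown; [|apply Hb1]; lia|].
      intros i Hi'. destruct (Nat.eq_dec i l) as [->|]; [|apply Hb2; lia].
      split; [contradiction|]. intros Hi''%Hb. lia. }
  assert (Hpa : forall i l, i < l -> (mem i (pa l) <-> mem i (pa (S i)))).
  { intros i l Hi. induction Hi as [|l Hi IH]; [tauto|]. rewrite <- IH. cbn [pa].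
    destruct (excluded_middle_informative _); [tauto|]. rewrite mem_setbit. intuition lia. }
  exists (fun i => mem i (pa (S i))). intros p q Hp Hq HR.
  destruct (Hext (p + q) (p + q) (Nat.le_refl _)) as (b & Hb1 & Hb2).
  apply Hb1. exists p, q. split; [|split; [|assumption]]; intros i Hi; assert (Hlt := mem_lt _ _ Hi).
  - apply Hb2; [lia|]. apply Hpa; [lia|]. now apply Hp.
  - split; [lia|]. intros Hbi. apply (Hq i Hi). apply (Hpa i (p + q)); [lia|]. apply Hb2; [lia | assumption].
Qed.

Lemma compactness_union (R : nat -> nat -> Prop) :
  (forall s s' c, s <= s' -> R s c -> R s' c) -> (forall s, ~ empty_class (R s)) ->
  exists Y, forall s, pi_class (R s) Y.
Proof.
  intros Hm HE. destruct (compactness (fun c => exists s, R s c)) as [Y HY].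
  - intros [l H].
    destruct (eventually_all (fun a s => exists p q, (forall i, mem i p -> mem i a) /\
      (forall i, mem i q -> i < l /\ ~ mem i a) /\ R s (pr p q)) (2 ^ l)) as [s Hs].
    + intros a s s' (p & q & H1 & H2 & H3) Hs. exists p, q. eauto.
    + intros a Ha. destruct (H a Ha) as (p & q & H1 & H2 & s & H3). exists s, p, q. auto.
    + apply (HE s). now exists l.
  - exists Y. intros s p q Hp Hq HR. apply (HY p q Hp Hq). now exists s.
Qed.

Lemma dependent_choice (T : Type) (I : T -> Prop) (S' : nat -> T -> T -> Prop) (t0 : T) :
  I t0 -> (forall n t, I t -> exists t', I t' /\ S' n t t') ->
  exists f : nat -> T, f 0 = t0 /\ forall n, I (f n) /\ S' n (f n) (f (S n)).
Proof.
  intros H0 HS.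
  set (step := fun n (t : {t | I t}) =>
    let s := constructive_indefinite_description _ (HS n (proj1_sig t) (proj2_sig t)) in
    exist I (proj1_sig s) (proj1 (proj2_sig s))).
  set (f := fix f n := match n with 0 => exist I t0 H0 | S m => step m (f m) end).
  exists (fun n => proj1_sig (f n)). split; [reflexivity|]. intros n.
  split; [apply proj2_sig|]. cbn [f]. unfold step at 1. cbn [proj1_sig].
  exact (proj2 (proj2_sig (constructive_indefinite_description _
    (HS n (proj1_sig (f n)) (proj2_sig (f n)))))).
Qed.

(* If [x] belongs to [W_e^(H + Y)] for all [Y] of the class, then this is enumerated by [H];
   hence the set of these [x] is not [B], and the class can be shrunk to force [W_e <> B]. *)
Lemma basis_avoid H B R : ~ re H B -> re H R -> ~ empty_class R ->
  exists Y, pi_class R Y /\ ~ re (join H Y) B.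
Proof.
  intros HB HR HE. destruct (join_use H jump reu_jump) as (W & HW & HJ).
  destruct (dependent_choice (nat -> Prop) (fun R => re H R /\ ~ empty_class R)
    (fun e R R' => (forall c, R c -> R' c) /\
       forall Y, pi_class R' Y -> ~ forall x, B x <-> jump (join H Y) (pr e x)) R) as (f & Hf0 & Hf).
  - now split.
  - clear R HR HE. intros e R [HR HE].
    assert (HS : exists x, ~ (B x <-> empty_class (fun c => R c \/ W (pr (pr e x) c)))).
    { apply NNPP. intros Hn. apply HB.
      apply (re_ext _ (fun x => empty_class ((fun x c => R c \/ W (pr (pr e x) c)) x))).
      - intros x. apply NNPP. intros Hx. apply Hn. exists x. intros Hx'. apply Hx.
        symmetry. exact Hx'.
      - apply re_empty_class. re_tac. }
    destruct HS as [x Hx].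
    destruct (classic (empty_class (fun c => R c \/ W (pr (pr e x) c)))) as [Hs|Hs].
    + exists R. split; [tauto|]. split; [tauto|]. intros Y HY Hall. apply Hx.
      split; [tauto|]. intros _. apply Hall. apply HJ.
      destruct (empty_class_sound _ Y Hs) as (p & q & Hp & Hq & [H1|H1]); [elim (HY p q Hp Hq H1) | eauto].
    + exists (fun c => R c \/ W (pr (pr e x) c)). split; [split; [re_tac | assumption]|].
      split; [tauto|]. intros Y HY Hall. apply Hx. split; [|tauto]. intros Hb.
      apply Hall, HJ in Hb as (p & q & Hp & Hq & H1). elim (HY p q Hp Hq). tauto.
  - assert (Hmono : forall s s' c, s <= s' -> f s c -> f s' c).
    { intros s s' c Hs. induction Hs as [|s' Hs IH]; [tauto|]. intros Hc.
      apply (proj2 (Hf s')). auto. }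
    destruct (compactness_union f Hmono) as [Y HY]; [intros s; apply Hf|].
    exists Y. split; [rewrite <- Hf0; apply HY|]. intros [e He]%re_index.
    destruct (Hf e) as [_ [_ H1]]. apply (H1 Y); [apply HY | assumption].
Qed.

(** The low basis theorem of Jockusch and Soare: decide the bits of the jump in turn, keeping each
    one out if the current class allows it. *)
Lemma basis_low H R : re H R -> ~ empty_class R ->
  exists Y, pi_class R Y /\ tle (jump (join H Y)) (jump H).
Proof.
  intros HR HE. destruct (join_use H jump reu_jump) as (W & HW & HJ).
  (* When the bits of the jump below [i] follow [a], no member of the class keeps [i] out. Being an
     emptiness question, this is decided by [jump H]. *)
  set (E := fun a i => empty_class (fun c => R c \/ (exists j, j < i /\ ~ mem j a /\ W (pr j c)) \/
                             W (pr i c))).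
  assert (HE' : re H (fun z => E (p1 z) (p2 z))).
  { unfold E. apply (re_empty_class H (fun z c => R c \/ (exists j, j < p2 z /\ ~ mem j (p1 z) /\ W (pr j c)) \/
                             W (pr (p2 z) c))). re_tac. }
  destruct (re_tle_jump _ _ HE') as [HE1 HE2].
  assert (Hagree : forall a b i, (forall j, j < i -> (mem j a <-> mem j b)) -> E a i -> E b i).
  { intros a b i Hab. apply empty_class_mono. intros c [Hc|[(j & Hj & Hja & Hw)|Hc]]; [tauto| |tauto].
    right; left. exists j. rewrite <- Hab; auto. }
  set (good := fun a e => forall i, i < e -> (mem i a /\ E a i) \/ (~ mem i a /\ ~ E a i)).
  assert (Huniq : forall a b e, good a e -> good b e -> forall i, i < e -> (mem i a <-> mem i b)).
  { intros a b e Ha Hb. induction i as [i IH] using lt_wf_ind. intros Hi.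
    assert (E a i <-> E b i).
    { split; apply Hagree; intros j Hj; [|symmetry]; apply IH; lia. }
    destruct (Ha i Hi), (Hb i Hi); tauto. }
  assert (Hex : forall e, exists a, good a e).
  { induction e as [|e [a IH]]; [exists 0; intros i Hi; lia|].
    set (a' := tr (fun i => (i < e /\ mem i a) \/ (i = e /\ E a e)) (S e)).
    assert (Haa : forall i, i < e -> (mem i a <-> mem i a')).
    { intros i Hi. unfold a'. rewrite mem_tr. intuition lia. }
    exists a'. intros i Hi.
    assert (HEE : E a i <-> E a' i).
    { split; apply Hagree; intros j Hj; [|symmetry]; apply Haa; lia. }
    destruct (Nat.eq_dec i e) as [->|].
    - assert (mem e a' <-> E a e) by (unfold a'; rewrite mem_tr; intuition lia).
      destruct (classic (E a e)); tauto.
    - rewrite <- Haa, <- HEE by lia. apply IH. lia. }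
  (* The bits that are forced in; [d] turns out to be the jump of the join. *)
  set (d := fun e => exists a, good a e /\ E a e).
  assert (Hd : forall a e, good a e -> (d e <-> E a e)).
  { intros a e Ha. split; [|intros; now exists a]. intros (b & Hb & Hbe).
    eapply Hagree; [|apply Hbe]. now apply Huniq. }
  assert (Hdm : forall a e, good a e -> forall i, i < e -> (mem i a <-> d i)).
  { intros a e Ha i Hi. rewrite (Hd a i); [destruct (Ha i Hi); tauto|].
    intros j Hj. apply Ha. lia. }
  assert (Hle : tle d (jump H)).
  { split.
    - unfold d, good. re_tac.
    - apply (re_ext _ (fun e => exists a, good a e /\ ~ E a e)).
      + intros e. split.
        * intros (a & Ha & Hn) Hde. now apply Hn, (Hd a e).
        * intros Hn. destruct (Hex e) as [a Ha]. exists a. split; [assumption|].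
          now rewrite <- Hd.
      + unfold good. re_tac. }
  destruct (compactness_union (fun e c => R c \/ exists j, j < e /\ ~ d j /\ W (pr j c)))
    as [Y HY].
  { intros s s' c Hs [Hc|(j & Hj & Hc)]; [tauto|]. right. exists j. split; [lia | assumption]. }
  { induction s as [|e IH].
    - intros Hn. apply HE. eapply empty_class_mono; [|apply Hn]. intros c [Hc|(j & Hj & _)]; [tauto | lia].
    - intros Hn. destruct (Hex e) as [a Ha]. destruct (classic (d e)) as [Hde|Hde].
      + apply IH. eapply empty_class_mono; [|apply Hn]. intros c [Hc|(j & Hj & Hdj & Hc)]; [tauto|].
        right. exists j. split; [|tauto].
        destruct (Nat.eq_dec j e) as [->|]; [contradiction | lia].
      + rewrite (Hd a e Ha) in Hde. apply Hde. eapply empty_class_mono; [|apply Hn].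
        intros c [Hc|(j & Hj & Hdj & Hc)]; [tauto|]. right.
        destruct (Nat.eq_dec j e) as [->|]; [now right|]. left. exists j. split; [lia|].
        rewrite (Hdm a e Ha); [tauto | lia]. }
  exists Y. split; [intros p q Hp Hq Hn; apply (HY 0 p q Hp Hq); tauto|].
  assert (HdJ : forall e, d e <-> jump (join H Y) e).
  { intros e. split.
    - intros (a & Ha & Hae). destruct (empty_class_sound _ Y Hae) as (p & q & Hp & Hq & Hc).
      destruct Hc as [Hc|[(j & Hj & Hja & Hc)|Hc]].
      + elim (HY 0 p q Hp Hq). tauto.
      + elim (HY e p q Hp Hq). right. exists j. rewrite <- (Hdm a e Ha) by assumption. tauto.
      + apply HJ. eauto.
    - intros (p & q & Hp & Hq & Hc)%HJ. apply NNPP. intros Hn.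
      elim (HY (S e) p q Hp Hq). right. exists e. auto. }
  destruct Hle as [H1 H2]. split; [apply (re_ext _ d) | apply (re_ext _ (compl d))]; trivial;
    intros x; now rewrite HdJ.
Qed.

(** With a jump to spare a low member works; with none, [B] has to be diagonalized against
    directly. *)
Lemma basis m H B R : ~ re (jumpn m H) B -> re H R -> ~ empty_class R ->
  exists Y, pi_class R Y /\ ~ re (jumpn m (join H Y)) B.
Proof.
  destruct m as [|m]; [apply basis_avoid|]. cbn [jumpn]. intros HB HR HE.
  destruct (basis_low H R HR HE) as (Y & HY & Hle). exists Y. split; [assumption|].
  intros Hre. apply HB. eapply re_tle; [|apply Hre]. now apply jumpn_mono.
Qed.

(** * Splitting columns *)

Lemma set_ext (X Y : set) : (forall i, X i <-> Y i) -> X = Y.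
Proof.
  intros H. apply functional_extensionality. intros i. apply propositional_extensionality, H.
Qed.

Definition cap (X Y : set) : set := fun i => X i /\ Y i.
Definition diff (X Y : set) : set := fun i => X i /\ ~ Y i.

Lemma tle_cap X Y K : tle X K -> tle Y K -> tle (cap X Y) K.
Proof.
  intros [X1 X2] [Y1 Y2]. split; [unfold cap; re_tac|].
  apply (re_ext _ (fun i => ~ X i \/ ~ Y i)); [intros i; unfold cap; tauto | re_tac].
Qed.

Lemma tle_diff X Y K : tle X K -> tle Y K -> tle (diff X Y) K.
Proof.
  intros [X1 X2] [Y1 Y2]. split; [unfold diff; re_tac|].
  apply (re_ext _ (fun i => ~ X i \/ Y i)); [|re_tac].
  intros i. unfold diff. destruct (classic (Y i)); tauto.
Qed.

Lemma not_re_join_cap K B Z N : tle N K -> ~ re (join K Z) B -> ~ re (join K (cap Z N)) B.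
Proof.
  intros HN HZ H. apply HZ. eapply re_tle; [|apply H]. apply join_tle; [apply tle_join_l|].
  apply tle_cap; [apply tle_join_r|]. eapply tle_trans; [apply HN | apply tle_join_l].
Qed.

(** A Boolean combination of the columns of [S], column [i] being the set of [x] with [pr i x] in
    [S]. *)
Definition cell (S : set) (p q : nat) : set := fun x =>
  (forall i, mem i p -> S (pr i x)) /\ (forall i, mem i q -> ~ S (pr i x)).

Lemma cell_lor S p q p' q' x :
  cell S (Nat.lor p p') (Nat.lor q q') x <-> cell S p q x /\ cell S p' q' x.
Proof.
  unfold cell. setoid_rewrite mem_lor. split.
  - intros [H1 H2]. repeat split; intros i Hi; auto.
  - intros [[H1 H2] [H3 H4]]. split; intros i [Hi|Hi]; auto.
Qed.

Definition stages (T : set -> nat -> nat -> Prop) : Prop :=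
  reu (fun X z => T X (p1 z) (p2 z)) /\ reu (fun X z => ~ T X (p1 z) (p2 z)) /\
  (forall X w w' x, w <= w' -> T X w x -> T X w' x) /\
  (forall X x, jump X x <-> exists w, T X w x).

(* [idx K c] is the Sigma^0_1(K) open class with index [c]. *)
Definition idx (K : set) (c E : nat) : Prop := jump K (pr (p1 c) (pr (p2 c) E)).
Definition sidx (T : set -> nat -> nat -> Prop) (K : set) (w c E : nat) : Prop :=
  T K w (pr (p1 c) (pr (p2 c) E)).

(* At stage [w], the string [b] of length [w] does not split [N] into a part outside the class
   [e] and a part outside the class [f]. *)
Definition bad T (K N : set) (e f w b : nat) : Prop :=
  exists E, E < S w /\ sub E N /\
    (((forall i, mem i E -> mem i b) /\ sidx T K w e E) \/
     ((forall i, mem i E -> ~ mem i b) /\ sidx T K w f E)).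

(** Badness persists to longer strings and later stages, so the strings that are not bad form a
    tree. *)
Lemma bad_restrict T K N e f w v b : stages T -> w <= v ->
  bad T K N e f w (tr (fun i => mem i b) w) -> bad T K N e f v b.
Proof.
  intros (_ & _ & Hm & _) Hw (E & HE & HN & H). exists E. split; [lia|]. split; [assumption|].
  destruct H as [[H1 H2]|[H1 H2]]; [left | right]; (split; [|eapply Hm; eassumption]).
  - intros i Hi. apply H1, mem_tr in Hi. tauto.
  - intros i Hi Hb. apply (H1 i Hi). apply mem_tr. split; [|assumption].
    apply mem_lt in Hi. lia.
Qed.

(** Asking for success only at stages where some string succeeds keeps the requirement Pi^0_1. If
    every stage has a good string, compactness gives [Y]. Otherwise, let [v] be the first stage
    without one: a good string of the stage before [v] serves all earlier stages, and from [v] on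
    nothing is required. *)
Lemma column T K N e f : stages T ->
  exists Y, forall w, (exists b, b < 2 ^ w /\ ~ bad T K N e f w b) -> ~ bad T K N e f w (tr Y w).
Proof.
  intros HT. assert (HT' := HT). destruct HT' as (_ & _ & Hm & HJ).
  destruct (classic (forall w, exists b, b < 2 ^ w /\ ~ bad T K N e f w b)) as [Hall|Hn].
  (* Forbidden are finite subsets of [N] that lie inside [Y] and in class [e], or outside [Y] and in
     class [f]. *)
  - destruct (compactness (fun c => (sub (p1 c) N /\ p2 c = 0 /\ exists w, sidx T K w e (p1 c)) \/
       (sub (p2 c) N /\ p1 c = 0 /\ exists w, sidx T K w f (p2 c)))) as [Y HY].
    + intros [l Hl].
      destruct (eventually_all (fun a w => l <= w /\ exists E, E <= w /\ sub E N /\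
        (((forall i, mem i E -> mem i a) /\ sidx T K w e E) \/
         ((forall i, mem i E -> i < l /\ ~ mem i a) /\ sidx T K w f E))) (2 ^ l)) as [w Hw].
      * intros a w w' (Hlw & E & HE & HN & H) Hle. split; [lia|]. exists E. split; [lia|].
        split; [assumption|]. unfold sidx in *.
        destruct H as [[H1 H2]|[H1 H2]]; [left | right]; split; eauto.
      * intros a Ha. destruct (Hl a Ha) as (p & q & Hp & Hq & H). spr.
        destruct H as [(HN & _ & w & Hw)|(HN & _ & w & Hw)];
          exists (l + w + p + q); (split; [lia|]).
        -- exists p. split; [lia|]. split; [assumption|]. left. split; [assumption|].
           eapply Hm; [|apply Hw]. lia.
        -- exists q. split; [lia|]. split; [assumption|]. right. split; [assumption|].
           eapply Hm; [|apply Hw]. lia.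
      * destruct (Hall w) as (b & Hb & Hbad). apply Hbad.
        destruct (Hw (tr (fun i => mem i b) l) (tr_lt _ _)) as (Hlw & E & HE & HN & H).
        exists E. split; [lia|]. split; [assumption|].
        destruct H as [[H1 H2]|[H1 H2]]; [left | right]; (split; [|assumption]).
        -- intros i Hi. apply H1, mem_tr in Hi. tauto.
        -- intros i Hi Hib. apply H1 in Hi as [Hi1 Hi2]. apply Hi2, mem_tr. tauto.
    + exists Y. intros w _ (E & HE & HN & H).
      destruct H as [[H1 H2]|[H1 H2]].
      * apply (HY E 0); [intros i Hi%H1%mem_tr; tauto | intros i Hi%mem_0; tauto |].
        spr. left. eauto.
      * apply (HY 0 E); [intros i Hi%mem_0; tauto | | spr; right; eauto].
        intros i Hi HYi. apply (H1 i Hi), mem_tr. split; [|assumption]. apply mem_lt in Hi. lia.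
  - assert (Hmin : exists v, (forall b, b < 2 ^ v -> bad T K N e f v b) /\
       forall w, w < v -> exists b, b < 2 ^ w /\ ~ bad T K N e f w b).
    { apply not_all_ex_not in Hn as [v Hv]. revert Hv.
      induction v as [v IH] using lt_wf_ind. intros Hv.
      destruct (classic (forall w, w < v -> exists b, b < 2 ^ w /\ ~ bad T K N e f w b)) as [H|H].
      - exists v. split; [|assumption]. intros b Hb. apply NNPP. intros Hbad. apply Hv. eauto.
      - apply not_all_ex_not in H as [w H]. apply imply_to_and in H as [Hw H]. eauto. }
    destruct Hmin as (v & Hv1 & Hv2).
    assert (Hge : forall w, v <= w -> ~ exists b, b < 2 ^ w /\ ~ bad T K N e f w b).
    { intros w Hw (b & Hb & Hbad). apply Hbad. eapply bad_restrict; [assumption | apply Hw|].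
      apply Hv1, tr_lt. }
    destruct v as [|v].
    + exists O0. intros w Hw. elim (Hge w); [lia | assumption].
    + destruct (Hv2 v) as (b & Hb & Hbad); [lia|]. exists (fun i => mem i b). intros w Hw.
      destruct (le_lt_dec w v) as [Hle|Hlt]; [|elim (Hge w); [lia | assumption]].
      intros H. apply Hbad. eapply bad_restrict; eassumption.
Qed.

Definition splits T (K S : set) : Prop := forall e f p q w,
  let N := cell S p q in
  (exists b, b < 2 ^ w /\ ~ bad T K N e f w b) ->
  ~ bad T K N e f w (tr (fun x => S (pr (pr (pr e f) (pr p q)) x)) w).

(** Columns are built by recursion on their index: the cell treated by column [c] involves only
    columns [i < c], since the codes [p] and [q] are at most [c]. *)
Lemma splits_ex T K : stages T -> exists S, splits T K S.
Proof.
  intros HT.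
  assert (G : forall c N, {Y | forall w,
    (exists b, b < 2 ^ w /\ ~ bad T K N (p1 (p1 c)) (p2 (p1 c)) w b) ->
    ~ bad T K N (p1 (p1 c)) (p2 (p1 c)) w (tr Y w)}).
  { intros c N. apply constructive_indefinite_description. now apply column. }
  set (SA := fix SA j : set := match j with
     | 0 => O0
     | S k => fun z => (p1 z = k /\ proj1_sig (G k (cell (SA k) (p1 (p2 k)) (p2 (p2 k)))) (p2 z)) \/
                       (p1 z <> k /\ SA k z) end).
  set (Z := fun z => SA (S (p1 z)) z).
  assert (HZ : forall i x j, i < j -> (Z (pr i x) <-> SA j (pr i x))).
  { intros i x j Hj. unfold Z. rewrite p1_pr. induction Hj as [|j Hj IH]; [tauto|].
    rewrite IH. cbn [SA]. rewrite p1_pr. fold SA. intuition lia. }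
  exists Z. intros e f p q w N. set (c := pr (pr e f) (pr p q)).
  assert (HN : N = cell (SA c) p q).
  { apply set_ext. intros x. unfold N, cell.
    assert (Hp : p <= c) by (unfold c; etransitivity; [apply (le_pr_l p q) | apply le_pr_r]).
    assert (Hq : q <= c) by (unfold c; etransitivity; [apply (le_pr_r p q) | apply le_pr_r]).
    split; intros [H1 H2]; (split; intros i Hi; assert (Hlt := mem_lt _ _ Hi)).
    - apply HZ; [lia | auto].
    - rewrite <- HZ by lia. auto.
    - apply (HZ i x c); [lia | auto].
    - rewrite (HZ i x c) by lia. auto. }
  assert (HY : (fun x => Z (pr c x)) = proj1_sig (G c (cell (SA c) p q))).
  { apply set_ext. intros x. unfold Z. rewrite p1_pr. cbn [SA]. fold SA. rewrite p1_pr, p2_pr.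
    replace (p1 (p2 c)) with p by (unfold c; now spr).
    replace (p2 (p2 c)) with q by (unfold c; now spr). tauto. }
  rewrite HY, HN. assert (H := proj2_sig (G c (cell (SA c) p q)) w).
  revert H. generalize (proj1_sig (G c (cell (SA c) p q))). intros Y.
  replace (p1 (p1 c)) with e by (unfold c; now spr).
  replace (p2 (p1 c)) with f by (unfold c; now spr). tauto.
Qed.

(** Badness is decidable uniformly in [K] joined with [S], so a violation of [splits] is a Sigma^0_1
    event. *)
Lemma splits_class T K : stages T -> exists R, re K R /\ forall S, splits T K S <-> pi_class R S.
Proof.
  intros (HT1 & HT2 & _ & _).
  set (F := fun (X : set) i => X (pr 0 i)).
  assert (HF1 : reu F) by (unfold F; reu_tac).
  assert (HF2 : reu (fun X i => ~ F X i)) by (unfold F; reu_tac).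
  assert (HTF1 := reu_comp F _ HF1 HF2 HT1). assert (HTF2 := reu_comp F _ HF1 HF2 HT2).
  cbv beta in HTF1, HTF2.
  set (G := fun (X : set) i => X (pr 1 i)).
  assert (Hs1 : forall w c E, fn w -> fn c -> fn E ->
     reu (fun X x => sidx T (F X) (w x) (c x) (E x))).
  { intros w c E Hw Hc HE. unfold sidx.
    eapply reu_ext; [|refine (reu_sub _ (fun x => pr (w x) (pr (p1 (c x)) (pr (p2 (c x)) (E x)))) _ HTF1)].
    - intros X x. cbv beta. spr. reflexivity.
    - repeat apply fn_pr; trivial; [apply fn_p1 | apply fn_p2]; assumption. }
  assert (Hs2 : forall w c E, fn w -> fn c -> fn E ->
     reu (fun X x => ~ sidx T (F X) (w x) (c x) (E x))).
  { intros w c E Hw Hc HE. unfold sidx.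
    eapply reu_ext; [|refine (reu_sub _ (fun x => pr (w x) (pr (p1 (c x)) (pr (p2 (c x)) (E x)))) _ HTF2)].
    - intros X x. cbv beta. spr. reflexivity.
    - repeat apply fn_pr; trivial; [apply fn_p1 | apply fn_p2]; assumption. }
  assert (HB1 : forall p q e f w b, fn p -> fn q -> fn e -> fn f -> fn w -> fn b ->
     reu (fun X x => bad T (F X) (cell (G X) (p x) (q x)) (e x) (f x) (w x) (b x))).
  { intros p q e f w b Hp Hq He Hf Hw Hb.
    unfold bad, sub, cell, G. reu_tac; apply Hs1; fn_tac. }
  assert (HB2 : forall p q e f w b, fn p -> fn q -> fn e -> fn f -> fn w -> fn b ->
     reu (fun X x => ~ bad T (F X) (cell (G X) (p x) (q x)) (e x) (f x) (w x) (b x))).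
  { intros p q e f w b Hp Hq He Hf Hw Hb.
    apply (reu_ext (fun X x =>
      forall E, E < S (w x) ->
       (exists j, mem j E /\ ((exists i, mem i (p x) /\ ~ X (pr 1 (pr i j))) \/
                              (exists i, mem i (q x) /\ X (pr 1 (pr i j))))) \/
       (((exists i, mem i E /\ ~ mem i (b x)) \/ ~ sidx T (F X) (w x) (e x) E) /\
        ((exists i, mem i E /\ mem i (b x)) \/ ~ sidx T (F X) (w x) (f x) E)))).
    - intros X x. unfold bad, sub, cell, G. split.
      + intros H (E & HE & HN & HD). destruct (H E HE) as [(j & Hj & H1)|[H1 H2]].
        * destruct (HN j Hj) as [N1 N2]. destruct H1 as [(i & Hi & H1)|(i & Hi & H1)]; [auto|].
          now apply (N2 i).
        * destruct HD as [[D1 D2]|[D1 D2]].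
          -- destruct H1 as [(i & Hi & H1)|H1]; auto.
          -- destruct H2 as [(i & Hi & H2)|H2]; [apply (D1 i)|]; auto.
      + intros H E HE. apply NNPP. intros Hn. apply H. exists E. split; [assumption|].
        apply not_or_and in Hn as [Hn1 Hn2]. split.
        * intros j Hj. split.
          -- intros i Hi. apply NNPP. intros Hx. apply Hn1. exists j. eauto.
          -- intros i Hi Hx. apply Hn1. exists j. eauto.
        * apply not_and_or in Hn2 as [Hn2|Hn2]; apply not_or_and in Hn2 as [Ha Hb'];
            apply NNPP in Hb'; [left | right]; (split; [|assumption]).
          -- intros i Hi. apply NNPP. intros Hx. apply Ha. eauto.
          -- intros i Hi Hx. apply Ha. eauto.
    - reu_tac; apply Hs2; fn_tac. }
  (* A violation: [b] is a good string, while [b'], the true initial segment of the column, is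
     bad. *)
  set (V := fun (X : set) (_ : nat) => exists e f p q w b b', b < 2 ^ w /\
     ~ bad T (F X) (cell (G X) p q) e f w b /\
     (forall x, x < w -> (mem x b' /\ X (pr 1 (pr (pr (pr e f) (pr p q)) x))) \/
                         (~ mem x b' /\ ~ X (pr 1 (pr (pr (pr e f) (pr p q)) x)))) /\
     b' < 2 ^ w /\ bad T (F X) (cell (G X) p q) e f w b').
  assert (HV : reu V).
  { unfold V. reu_tac; [apply HB2 | apply HB1]; fn_tac. }
  destruct (join_use K V HV) as (R & HR & HVR).
  exists (fun c => R (pr 0 c)). split; [re_tac|]. intros Z.
  assert (HF : F (join K Z) = K) by (apply set_ext; intros i; apply join_0).
  assert (HG : G (join K Z) = Z) by (apply set_ext; intros i; apply join_1).
  assert (HVZ : splits T K Z <-> ~ V (join K Z) 0).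
  { unfold V. rewrite HF, HG. split.
    - intros H (e & f & p & q & w & b & b' & Hb & HbB & Hb' & Hbw & HB).
      apply (H e f p q w); [eauto|].
      replace (tr _ w) with b'; [assumption|]. apply mem_ext. intros i. rewrite mem_tr.
      split.
      + intros Hi. assert (Hlt := mem_lt_pow _ _ _ Hbw Hi). split; [assumption|].
        destruct (Hb' i Hlt) as [[_ Hj]|[Hj _]]; [now apply join_1 in Hj | contradiction].
      + intros [Hlt Hi]. destruct (Hb' i Hlt) as [[Hj _]|[_ Hj]]; [assumption|].
        elim Hj. now apply join_1.
    - intros H e f p q w N (b & Hb & HbB) HB. apply H.
      exists e, f, p, q, w, b, (tr (fun x => Z (pr (pr (pr e f) (pr p q)) x)) w).
      repeat split; trivial; [|apply tr_lt].
      intros x Hx. rewrite mem_tr. rewrite join_1.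
      destruct (classic (Z (pr (pr (pr e f) (pr p q)) x))); tauto. }
  rewrite HVZ, HVR. unfold pi_class. split.
  - intros H p q Hp Hq HRc. apply H. eauto.
  - intros H (p & q & Hp & Hq & HRc). apply (H p q Hp Hq HRc).
Qed.

Lemma splits_basis m K B T : stages T -> ~ re (jumpn m K) B ->
  exists S, splits T K S /\ ~ re (jumpn m (join K S)) B.
Proof.
  intros HT HB. destruct (splits_class T K HT) as (R & HR & HS).
  destruct (basis m K B R HB HR) as (Y & HY & HYB).
  - intros HE. destruct (splits_ex T K HT) as [S0 H0]. apply HS in H0.
    destruct (empty_class_sound _ S0 HE) as (p & q & Hp & Hq & H). now apply (H0 p q).
  - exists Y. split; [now apply HS | assumption].
Qed.

Lemma splits_spec T K Z e f p q : stages T -> splits T K Z ->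
  (forall w, exists b, b < 2 ^ w /\ ~ bad T K (cell Z p q) e f w b) ->
  let Y := fun x => Z (pr (pr (pr e f) (pr p q)) x) in
  (forall E, sub E (cell Z p q) -> sub E Y -> ~ idx K e E) /\
  (forall E, sub E (cell Z p q) -> dis E Y -> ~ idx K f E).
Proof.
  intros (_ & _ & Hm & HJ) HZ Hw Y. split; intros E HN HY [w Hidx]%HJ;
    apply (HZ e f p q (E + w) (Hw _)); exists E; (split; [lia|]); (split; [assumption|]);
    [left | right]; (split; [|eapply Hm; [|apply Hidx]; lia]); intros i Hi.
  - apply mem_tr. split; [apply mem_lt in Hi; lia | now apply HY].
  - rewrite mem_tr. intros [_ H]. now apply (HY i).
Qed.

(** * Partition regular classes *)

(** An intersection of uniformly Sigma^0_1(K) open classes; membership is witnessed by finite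
    subsets, hence closed upwards. *)
Definition pi2_family (K : set) (P : set -> Prop) : Prop :=
  exists Q, re K (fun z => Q (p1 z) (p2 z)) /\
    forall Z, P Z <-> forall i, exists E, sub E Z /\ Q i E.

Definition partition_regular (P : set -> Prop) : Prop :=
  forall Z Y, P Z -> P (cap Z Y) \/ P (diff Z Y).

Lemma sub_trans E (X Y : set) : (forall i, X i -> Y i) -> sub E X -> sub E Y.
Proof. intros H HE i Hi. auto. Qed.

Lemma pi2_family_up K P Z Y : pi2_family K P -> (forall i, Z i -> Y i) -> P Z -> P Y.
Proof.
  intros (Q & _ & HQ) HZY HZ. apply HQ. intros i. destruct (proj1 (HQ Z) HZ i) as (E & HE & H).
  exists E. split; [eapply sub_trans; eassumption | assumption].
Qed.

Lemma sub_0 X : sub 0 X.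
Proof. intros i Hi%mem_0. tauto. Qed.

Lemma dis_0 X : dis 0 X.
Proof. intros i Hi%mem_0. tauto. Qed.

Lemma sub_lor p q X : sub p X -> sub q X -> sub (Nat.lor p q) X.
Proof. intros H1 H2 i [Hi|Hi]%mem_lor; auto. Qed.

Lemma dis_lor p q X : dis p X -> dis q X -> dis (Nat.lor p q) X.
Proof. intros H1 H2 i [Hi|Hi]%mem_lor; auto. Qed.

(* [T z] decides whether the members of [P] must meet the open class [v z]. *)
Definition answers (K : set) (P : set -> Prop) (v : nat -> nat -> Prop) (T : nat -> Prop) : Prop :=
  re K (compl T) /\
  (forall z, T z -> forall Z, P Z -> exists E, sub E Z /\ v z E) /\
  (forall z, ~ T z -> exists N, tle N K /\ (forall Z, P Z -> P (cap Z N)) /\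
     forall E, sub E N -> ~ v z E).

(** One level of the tower, for one jump. The new oracle is the jump of [K] with splitting columns,
    joined with an ultrafilter [u] on the cells. *)
Lemma step m K B P : pi2_family K P -> partition_regular P -> P (fun _ => True) ->
  ~ re (jumpn (S m) K) B ->
  exists K' P', tle K K' /\ ~ re (jumpn m K') B /\ pi2_family K' P' /\ partition_regular P' /\ P' (fun _ => True) /\
    (forall Z, P' Z -> P Z) /\
    forall v, re K (fun z => v (p1 z) (p2 z)) -> exists T, answers K' P' v T.
Proof.
  intros HnP HpP HPT HB. assert (HnP' := HnP). destruct HnP' as (Q & HQ & HPQ).
  destruct (reu_stage _ reu_jump) as (T & HT). fold (stages T) in HT.
  destruct (splits_basis (S m) K B T HT HB) as (Z0 & HZ0 & HB0). cbn [jumpn] in HB0.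
  (* [Z0] was found with a jump to spare, hence low over [K]. Its jump [H] decides whether a cell
     meets a given Sigma^0_1(K) open class. *)
  set (KS := join K Z0) in *. set (H := jump KS) in *.
  assert (HK : tle K KS) by apply tle_join_l. assert (HS : tle Z0 KS) by apply tle_join_r.
  assert (HKSH : tle KS H) by apply tle_jump.
  assert (HQS := re_tle _ _ _ HK HQ). destruct HS as [HS1 HS2].
  assert (HJS : re KS (jump K)) by (eapply re_tle; [apply HK | apply re_jump]).
  set (hitU := fun t => exists E, sub E (cell Z0 (p1 (p2 t)) (p2 (p2 t))) /\ idx K (p1 t) E).
  assert (HhU : re KS hitU).
  { unfold hitU, idx, sub, cell. re_tac. }
  set (hitQ := fun t => exists E, sub E (cell Z0 (p1 (p2 t)) (p2 (p2 t))) /\ Q (p1 t) E).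
  assert (HhQ : re KS hitQ) by (unfold hitQ, sub, cell; re_tac).
  destruct (re_tle_jump _ _ HhU) as [HU1 HU2]. destruct (re_tle_jump _ _ HhQ) as [HQ1 HQ2].
  fold H in HU1, HU2, HQ1, HQ2.
  (* Conditions whose cell falls outside [P] are forbidden, so [u] selects only cells in [P]. *)
  set (R := fun c => exists i, ~ hitQ (pr i c)).
  assert (HR : re H R) by (unfold R; re_tac).
  assert (HPR : forall p q, P (cell Z0 p q) <-> ~ R (pr p q)).
  { intros p q. rewrite HPQ. unfold R, hitQ. split.
    - intros HE [i Hi]. apply Hi. spr. apply HE.
    - intros HE i. apply NNPP. intros Hn. apply HE. exists i. now spr. }
  assert (HRE : ~ empty_class R).
  { assert (Hl : forall l, exists a, a < 2 ^ l /\
        P (fun x => forall i, i < l -> (mem i a <-> Z0 (pr i x)))).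
    { induction l as [|l (a & Ha & IH)].
      - exists 0. split; [cbn; lia|]. eapply pi2_family_up; [eassumption| |apply HPT]. intros; lia.
      - destruct (HpP _ (fun x => Z0 (pr l x)) IH) as [H1|H1].
        + exists (Nat.setbit a l). split.
          * apply mem_bound. intros i [->|Hi]%mem_setbit; [lia|].
            apply (mem_lt_pow _ _ _ Ha) in Hi. lia.
          * eapply pi2_family_up; [eassumption| |apply H1]. intros x [H2 H3] i Hi.
            rewrite mem_setbit. destruct (Nat.eq_dec i l) as [->|]; [tauto|].
            rewrite <- H2 by lia. tauto.
        + exists a. split; [cbn; lia|].
          eapply pi2_family_up; [eassumption| |apply H1]. intros x [H2 H3] i Hi.
          destruct (Nat.eq_dec i l) as [->|]; [|apply H2; lia].
          split; [|contradiction]. intros Hm. apply (mem_lt_pow _ _ _ Ha) in Hm. lia. }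
    intros [l HE]. destruct (Hl l) as (a & Ha & HPa).
    destruct (HE a Ha) as (p & q & Hp & Hq & Hpq). apply (HPR p q); [|assumption].
    eapply pi2_family_up; [eassumption| |apply HPa]. intros x Hx. split; intros i Hi.
    - apply Hp in Hi. apply Hx; [|assumption]. apply (mem_lt_pow _ _ _ Ha Hi).
    - apply Hq in Hi as [H1 H2]. intros Hz. now apply H2, Hx. }
  destruct (basis m H B R HB0 HR HRE) as (u & Hu & HBu).
  set (K' := join H u) in *.
  assert (HHK' : tle H K') by apply tle_join_l. assert (Huk : tle u K') by apply tle_join_r.
  assert (HSK' : tle KS K') by (eapply tle_trans; eassumption).
  assert (HPN : forall p q, sub p u -> dis q u -> P (cell Z0 p q)).
  { intros p q Hp Hq. apply HPR. now apply Hu. }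
  (* The open classes containing [u]. The matrix is decided by [H], so [C] is Pi^0_1 in [K']. *)
  set (C := fun c => forall p q, sub p u -> dis q u ->
              exists E, sub E (cell Z0 p q) /\ idx K c E).
  assert (HC : re K' (compl C)).
  { apply (re_ext _ (fun c => exists p q, (forall i, mem i p -> u i) /\
       (forall i, mem i q -> ~ u i) /\ ~ hitU (pr c (pr p q)))).
    - intros c. unfold C, hitU. split.
      + intros (p & q & Hp & Hq & Hh) Hc. apply Hh. spr. now apply Hc.
      + intros Hc. apply NNPP. intros Hn. apply Hc. intros p q Hp Hq. apply NNPP. intros Hh.
        apply Hn. exists p, q. spr. auto.
    - assert (HU2' := re_tle _ _ _ HHK' HU2). destruct Huk as [Hu1 Hu2]. re_tac. }
  set (P' := fun Z : set => forall c p q, C c -> sub p u -> dis q u ->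
               exists E, sub E Z /\ sub E (cell Z0 p q) /\ idx K c E).
  assert (Hindex : forall v : nat -> nat -> Prop, re K (fun z => v (p1 z) (p2 z)) ->
            exists e, forall z E, v z E <-> idx K (pr e z) E).
  { intros v [e He]%re_index. exists e. intros z E. unfold idx. spr. rewrite <- He. now spr. }
  assert (HP'P : forall Z, P' Z -> P Z).
  { intros Z HZ. apply HPQ. intros i. destruct (Hindex Q HQ) as [e He].
    destruct (HZ (pr e i) 0 0) as (E & HE & _ & HEi).
    - intros p q Hp Hq. assert (HN := HPN p q Hp Hq).
      destruct (proj1 (HPQ _) HN i) as (E & HE & HEi).
      exists E. split; [assumption | now apply He].
    - apply sub_0.
    - apply dis_0.
    - exists E. split; [assumption | now apply He]. }
  assert (HPcap : forall Z p q, sub p u -> dis q u -> P' Z -> P' (cap Z (cell Z0 p q))).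
  { intros Z p q Hp Hq HZ c p' q' Hc Hp' Hq'.
    destruct (HZ c (Nat.lor p p') (Nat.lor q q')) as (E & HE & HEN & HEc);
      [assumption | now apply sub_lor | now apply dis_lor |].
    exists E. split; [|split; [|assumption]]; intros i Hi.
    - split; [auto|]. apply HEN, cell_lor in Hi. tauto.
    - apply HEN, cell_lor in Hi. tauto. }
  exists K', P'. split; [eapply tle_trans; eassumption|]. split; [assumption|].
  split; [|split; [|split; [|split; [assumption|]]]].
  (* The index [i] codes [c], [p] and [q]; the first three disjuncts release the triples over which
     [P'] does not range. *)
  - exists (fun i E => ~ C (p1 i) \/ (exists j, mem j (p1 (p2 i)) /\ ~ u j) \/
              (exists j, mem j (p2 (p2 i)) /\ u j) \/
              ((forall j, mem j E -> cell Z0 (p1 (p2 i)) (p2 (p2 i)) j) /\ idx K (p1 i) E)).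
    split.
    + assert (HS1' := re_tle _ _ _ HSK' HS1). assert (HS2' := re_tle _ _ _ HSK' HS2).
      assert (HJS' := re_tle _ _ _ HSK' HJS). destruct Huk as [Hu1 Hu2].
      unfold cell, idx. re_tac.
    + intros Z. split.
      * intros HZ i.
        destruct (classic (C (p1 i) /\ sub (p1 (p2 i)) u /\ dis (p2 (p2 i)) u)) as [(H1 & H2 & H3)|Hn].
        -- destruct (HZ _ _ _ H1 H2 H3) as (E & HE & HEN & HEc). exists E.
           split; [assumption|]. do 3 right. now split.
        -- exists 0. split; [apply sub_0|]. apply NNPP. intros Hn'. apply Hn.
           split; [apply NNPP; tauto|]. split.
           ++ intros j Hj. apply NNPP. intros Hu'. apply Hn'. right; left. eauto.
           ++ intros j Hj Hu'. apply Hn'. right; right; left. eauto.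
      * intros HZ c p q Hc Hp Hq. destruct (HZ (pr c (pr p q))) as (E & HE & HEi). spr.
        destruct HEi as [Hn|[(j & Hj & Hn)|[(j & Hj & Hn)|[H1 H2]]]].
        -- contradiction.
        -- elim Hn. now apply Hp.
        -- elim (Hq j Hj Hn).
        -- exists E. auto.
  - intros Z Y HZ. apply NNPP. intros Hn. apply not_or_and in Hn as [Hn1 Hn2].
    assert (Hneg : forall X, ~ P' X -> exists c p q, C c /\ sub p u /\ dis q u /\
              ~ exists E, sub E X /\ sub E (cell Z0 p q) /\ idx K c E).
    { intros X HX. apply NNPP. intros Hn. apply HX. intros c p q Hc Hp Hq. apply NNPP.
      intros Hn'. apply Hn. exists c, p, q. auto. }
    destruct (Hneg _ Hn1) as (c1 & a1 & b1 & Hc1 & Ha1 & Hb1 & HE1).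
    destruct (Hneg _ Hn2) as (c2 & a2 & b2 & Hc2 & Ha2 & Hb2 & HE2).
    (* The finite sets each of whose 2-partitions has a part in [c1] or [c2]. Testing [a < 2 ^ E]
       suffices, as the members of the set coded by [E] are below [E]. *)
    set (spl := fun _ E : nat => forall a, a < 2 ^ E ->
      (exists F, (forall i, mem i F -> mem i a /\ mem i E) /\ jump K (pr (p1 c1) (pr (p2 c1) F))) \/
      (exists F, (forall i, mem i F -> ~ mem i a /\ mem i E) /\ jump K (pr (p1 c2) (pr (p2 c2) F)))).
    assert (Hspl : re K (fun z => spl (p1 z) (p2 z))).
    { assert (HJK := re_jump K). unfold spl. re_tac. }
    destruct (Hindex spl Hspl) as [g Hg].
    destruct (classic (C (pr g 0))) as [HCg|HCg].
    + destruct (HZ _ (Nat.lor a1 a2) (Nat.lor b1 b2) HCg) as (E & HE & HEN & HEg);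
        [now apply sub_lor | now apply dis_lor|].
      apply Hg in HEg. destruct (HEg (tr Y E) (tr_lt _ _)) as [(F & HF & HFi)|(F & HF & HFi)].
      * apply HE1. exists F. split; [|split; [|exact HFi]]; intros i Hi; apply HF in Hi as [H1 H2].
        -- split; [auto|]. now apply mem_tr in H1.
        -- apply HEN, cell_lor in H2. tauto.
      * apply HE2. exists F. split; [|split; [|exact HFi]]; intros i Hi; apply HF in Hi as [H1 H2].
        -- split; [auto|]. intros HY. apply H1, mem_tr. split; [now apply mem_lt | assumption].
        -- apply HEN, cell_lor in H2. tauto.
    + assert (Hrs : exists r s, sub r u /\ dis s u /\ ~ exists E, sub E (cell Z0 r s) /\ spl 0 E).
      { apply NNPP. intros Hn. apply HCg. intros p q Hp Hq. apply NNPP. intros Hn'. apply Hn.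
        exists p, q. split; [assumption|]. split; [assumption|]. intros (E & HE & HEs).
        apply Hn'. exists E. split; [assumption | now apply Hg]. }
      destruct Hrs as (r & s & Hr & Hs & Hrs).
      (* If all strings were bad at stage [w], the truncation of the cell to [w] would belong to
         [spl]. *)
      assert (Hsp : forall w, exists b, b < 2 ^ w /\ ~ bad T K (cell Z0 r s) c1 c2 w b).
      { intros w. apply NNPP. intros Hn. apply Hrs. exists (tr (cell Z0 r s) w).
        split; [apply sub_tr|]. intros a _. apply NNPP. intros Ha. apply Hn.
        exists (tr (fun i => mem i a) w). split; [apply tr_lt|].
        intros (E & HE & HEN & HEb). apply Ha.
        assert (HEtr : forall i, mem i E -> i < w /\ mem i (tr (cell Z0 r s) w)).
        { intros i Hi. assert (Hlt := mem_lt _ _ Hi). rewrite mem_tr. split; [lia|].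
          split; [lia | auto]. }
        destruct HEb as [[H1 H2]|[H1 H2]]; [left | right]; exists E; split.
        - intros i Hi. split; [|now apply HEtr]. apply H1, mem_tr in Hi. tauto.
        - apply (proj2 (proj2 (proj2 HT))). eauto.
        - intros i Hi. split; [|now apply HEtr]. intros Hia. apply (H1 i Hi), mem_tr.
          split; [now apply HEtr | assumption].
        - apply (proj2 (proj2 (proj2 HT))). eauto. }
      destruct (splits_spec T K Z0 c1 c2 r s HT HZ0 Hsp) as [Hs1 Hs2].
      set (c := pr (pr c1 c2) (pr r s)) in *.
      (* Column [c] splits the cell of [r] and [s]. Whichever side [u] selects has no finite subset
         in [c1], respectively [c2], although both classes contain [u]. *)
      destruct (classic (u c)) as [Huc|Huc].
      * destruct (Hc1 (Nat.setbit r c) s) as (E & HE & HEc); [|assumption|].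
        { intros i [->|Hi]%mem_setbit; auto. }
        apply (Hs1 E); [| |assumption]; intros i Hi; apply HE in Hi as [H1 H2].
        -- split; [|assumption]. intros j Hj. apply H1, mem_setbit. tauto.
        -- apply H1, mem_setbit. tauto.
      * destruct (Hc2 r (Nat.setbit s c)) as (E & HE & HEc); [assumption| |].
        { intros i [->|Hi]%mem_setbit; auto. }
        apply (Hs2 E); [| |assumption]; intros i Hi; apply HE in Hi as [H1 H2].
        -- split; [assumption|]. intros j Hj. apply H2, mem_setbit. tauto.
        -- apply H2, mem_setbit. tauto.
  - intros c p q Hc Hp Hq. destruct (Hc p q Hp Hq) as (E & HE & HEc). exists E.
    split; [intros i _; exact I | auto].
  - intros v Hv. destruct (Hindex v Hv) as [e He]. exists (fun z => C (pr e z)).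
    split; [|split].
    + apply (re_sub _ (compl C)); [fn_tac | assumption].
    + intros z Hz Z HZ. destruct (HZ _ 0 0 Hz (sub_0 _) (dis_0 _)) as (E & HE & _ & HEe).
      exists E. split; [assumption | now apply He].
    + intros z Hz.
      assert (Hpq : exists p q, sub p u /\ dis q u /\ ~ exists E, sub E (cell Z0 p q) /\ v z E).
      { apply NNPP. intros Hn. apply Hz. intros p q Hp Hq. apply NNPP. intros Hn'. apply Hn.
        exists p, q. split; [assumption|]. split; [assumption|]. intros (E & HE & HEs).
        apply Hn'. exists E. split; [assumption | now apply He]. }
      destruct Hpq as (p & q & Hp & Hq & Hpq). exists (cell Z0 p q). split; [|split].
      * apply (tle_trans _ KS); [|assumption]. split.
        -- unfold cell. re_tac.
        -- apply (re_ext _ (fun x => (exists i, mem i p /\ ~ Z0 (pr i x)) \/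
                                     (exists i, mem i q /\ Z0 (pr i x)))); [|re_tac].
           intros x. unfold cell. split.
           ++ intros [(i & Hi & Hz')|(i & Hi & Hz')] [H1 H2]; [auto | now apply (H2 i)].
           ++ intros Hn. apply NNPP. intros Hn'. apply Hn. split.
              ** intros i Hi. apply NNPP. intros Hx. apply Hn'. left. eauto.
              ** intros i Hi Hx. apply Hn'. right. eauto.
      * intros Z HZ. now apply HPcap.
      * intros E HE HEv. apply Hpq. eauto.
Qed.

(** * Forcing *)

(* A string is coded by [<length, set of positions of ones>]; [extends Y s t] says that [t] extends
   [s] and that its new ones are in [Y]. *)
Definition extends (Y : set) (s t : nat) : Prop :=
  p1 s <= p1 t /\ forall i, i < p1 t ->
    (i < p1 s /\ ((mem i (p2 s) /\ mem i (p2 t)) \/ (~ mem i (p2 s) /\ ~ mem i (p2 t)))) \/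
    (p1 s <= i /\ (~ mem i (p2 t) \/ Y i)).

Lemma extends_refl Y s : extends Y s s.
Proof.
  split; [lia|]. intros i Hi. left. split; [assumption|]. destruct (classic (mem i (p2 s))); tauto.
Qed.

Lemma extends_old Y s t i : extends Y s t -> i < p1 s -> (mem i (p2 s) <-> mem i (p2 t)).
Proof. intros [H1 H2] Hi. destruct (H2 i) as [H|H]; [lia | tauto | lia]. Qed.

Lemma extends_new Y s t i : extends Y s t -> i < p1 t -> p1 s <= i -> mem i (p2 t) -> Y i.
Proof. intros [H1 H2] Hi Hs Hm. destruct (H2 i Hi) as [H|H]; [lia | tauto]. Qed.

Lemma extends_intro (Y : set) s t : p1 s <= p1 t ->
  (forall i, i < p1 s -> (mem i (p2 s) <-> mem i (p2 t))) ->
  (forall i, i < p1 t -> p1 s <= i -> mem i (p2 t) -> Y i) -> extends Y s t.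
Proof.
  intros H1 H2 H3. split; [assumption|]. intros i Hi. destruct (le_lt_dec (p1 s) i) as [Hs|Hs].
  - right. split; [assumption|]. destruct (classic (mem i (p2 t))); auto.
  - left. split; [assumption|]. specialize (H2 i Hs). destruct (classic (mem i (p2 s))); tauto.
Qed.

Lemma extends_trans (Y X : set) s t r :
  (forall i, X i -> Y i) -> extends Y s t -> extends X t r -> extends Y s r.
Proof.
  intros HXY H1 H2. assert (Hl1 := proj1 H1). assert (Hl2 := proj1 H2).
  apply extends_intro; [lia| |].
  - intros i Hi. rewrite (extends_old _ _ _ _ H1 Hi). apply (extends_old _ _ _ _ H2). lia.
  - intros i Hi Hs Hm. destruct (le_lt_dec (p1 t) i) as [Ht|Ht].
    + apply HXY. eapply extends_new; eassumption.
    + apply (extends_new _ _ _ i H1 Ht Hs). now apply (extends_old _ _ _ _ H2).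
Qed.

Lemma extends_mono (Y X : set) s t : (forall i, X i -> Y i) -> extends X s t -> extends Y s t.
Proof. intros H. apply extends_trans; [assumption | apply extends_refl]. Qed.

Lemma extends_fin Y s t : extends Y s t -> exists F, sub F Y /\ extends (fun i => mem i F) s t.
Proof.
  intros H. exists (tr (fun i => p1 s <= i /\ mem i (p2 t)) (p1 t)). split.
  - intros i (Hi & Hs & Hm)%mem_tr. eapply extends_new; eassumption.
  - apply extends_intro; [apply H | intros i Hi; eapply extends_old; eassumption |].
    intros i Hi Hs Hm. now apply mem_tr.
Qed.

Definition qst (e b s l : nat) : nat := pr e (pr b (pr s l)).

(* With [z = qst e b s l]: the string [s] makes the program [e] output [1 - b] on [l]. *)
Definition settled (z : nat) : Prop :=
  exists p q, (forall i, mem i p -> i < p1 (p1 (p2 (p2 z))) /\ mem i (p2 (p1 (p2 (p2 z))))) /\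
    (forall i, mem i q -> i < p1 (p1 (p2 (p2 z))) /\ ~ mem i (p2 (p1 (p2 (p2 z))))) /\
    Der (pr p q) (Fev (p1 z) (p2 (p2 (p2 z))) (1 - p1 (p2 z))).

(** For [z = qst e b s l]: new ones taken from [F] and a witness [y] make [E] hold with the opposite
    bit and with [y] prepended to the arguments. When [E] means refutability, this realises an outer
    existential quantifier. *)
Definition reach (E : nat -> Prop) (z F : nat) : Prop :=
  exists t y, extends (fun i => mem i F) (p1 (p2 (p2 z))) t /\
    E (qst (p1 z) (1 - p1 (p2 z)) t (S (pr y (p2 (p2 (p2 z)))))).

Lemma ce_settled : ce settled.
Proof. unfold settled, Fev. ce_tac. apply ce_Der_sub; fn_tac. Qed.

Lemma re_reach K E : re K E -> re K (fun z => reach E (p1 z) (p2 z)).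
Proof. intros HE. unfold reach, extends, qst. re_tac. Qed.

Lemma reach_qst E e b s l F : reach E (qst e b s l) F <->
  exists t y, extends (fun i => mem i F) s t /\ E (qst e (1 - b) t (S (pr y l))).
Proof. unfold reach, qst. spr. reflexivity. Qed.

Lemma settled_qst e b s l : settled (qst e b s l) <-> exists p q,
  (forall i, mem i p -> i < p1 s /\ mem i (p2 s)) /\
  (forall i, mem i q -> i < p1 s /\ ~ mem i (p2 s)) /\
  Der (pr p q) (Fev e l (1 - b)).
Proof. unfold settled, qst. spr. reflexivity. Qed.

(** [E m z] means that the Sigma_m statement coded in [z] can be refuted from its string by thinning
    the reservoir. As the negative answer to [reach (E m)], the predicate [E (S m)] is enumerable in
    the next oracle. *)
Definition tower (n : nat) (K : set) (P : set -> Prop) (E : nat -> nat -> Prop) : Prop :=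
  E 0 = settled /\ re K (E n) /\ pi2_family K P /\ partition_regular P /\ P (fun _ => True) /\
  (forall Z, P Z -> infinite_set Z) /\
  forall m, m < n -> exists T, answers K P (reach (E m)) T /\ E (S m) = compl T.

(** Induction on the levels built, [m] being the number of jumps still in hand. *)
Lemma tower_ex B j m : ~ re (jumpn (j + m) O0) B ->
  exists K P E, tower j K P E /\ ~ re (jumpn m K) B.
Proof.
  revert m. induction j as [|j IH]; intros m HB.
  - exists O0, infinite_set, (fun _ => settled). split; [|assumption].
    split; [reflexivity|]. split; [apply re_ce, ce_settled|]. split; [|split; [|split; [|split]]].
    + exists (fun i E => exists x, i <= x /\ mem x E). split; [re_tac|].
      intros Z. split.
      * intros HZ i. destruct (HZ i) as (x & Hx & HZx). exists (Nat.setbit 0 x). split.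
        -- intros k [->|Hk%mem_0]%mem_setbit; tauto.
        -- exists x. split; [assumption|]. apply mem_setbit. tauto.
      * intros HZ i. destruct (HZ i) as (E & HE & x & Hx & HxE). exists x. auto.
    + intros Z Y HZ. apply NNPP. intros Hn. apply not_or_and in Hn as [H1 H2].
      apply not_all_ex_not in H1 as [a Ha]. apply not_all_ex_not in H2 as [b Hb].
      destruct (HZ (a + b)) as (x & Hx & HZx). destruct (classic (Y x)).
      * apply Ha. exists x. split; [lia | now split].
      * apply Hb. exists x. split; [lia | now split].
    + intros i. exists i. split; [lia | exact I].
    + tauto.
    + intros k Hk. lia.
  - destruct (IH (S m)) as (K & P & E & (HE0 & HEj & Hn & Hp & HPT & Hinf & Hans) & HBK).
    { now replace (j + S m) with (S j + m) by lia. }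
    destruct (step m K B P Hn Hp HPT HBK)
      as (K' & P' & HKK & HB' & Hn' & Hp' & HPT' & HPP & Hstep).
    destruct (Hstep _ (re_reach _ _ HEj)) as (T & HT).
    exists K', P', (fun k => if k <=? j then E k else compl T).
    split; [|assumption]. split; [assumption|]. split.
    { replace (S j <=? j) with false by (symmetry; apply Nat.leb_gt; lia). apply HT. }
    split; [assumption|]. split; [assumption|]. split; [assumption|].
    split; [intros Z HZ; auto|].
    intros k Hk. replace (k <=? j) with true by (symmetry; apply Nat.leb_le; lia).
    destruct (Nat.eq_dec k j) as [->|Hkj].
    + exists T. split; [assumption|]. now replace (S j <=? j) with false by (symmetry; apply Nat.leb_gt; lia).
    + destruct (Hans k) as (T' & (H1 & H2 & H3) & HT'); [lia|]. exists T'.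
      split; [|now replace (S k <=? j) with true by (symmetry; apply Nat.leb_le; lia)].
      split; [eapply re_tle; eassumption|]. split; [intros z Hz Z HZ; auto|].
      intros z Hz. destruct (H3 z Hz) as (N & HN & HPN & HNv). exists N.
      split; [eapply tle_trans; eassumption|]. split; [|assumption].
      (* A thinning by [N] for the old class preserves the new one as well: otherwise [diff Z N]
         would be in [P'], hence in [P], and so would its empty intersection with [N]. *)
      intros Z HZ. destruct (Hp' Z N HZ) as [|Hd]; [assumption|].
      apply HPP, HPN, Hinf in Hd. destruct (Hd 0) as (x & _ & [_ Hx] & Hx'). contradiction.
Qed.

(** The refutation as achieved by a condition; [E (S k)] says only that thinning can achieve it. *)
Definition secured (E : nat -> nat -> Prop) (m z : nat) (Z : set) : Prop :=
  match m with 0 => E 0 z | S k => forall F, sub F Z -> ~ reach (E k) z F end.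

(** The prefix with universal quantifiers rewritten as negated existential ones; [b] records the
    parity, hence whether [R] or its complement is reached. Only Sigma statements are left to
    force. *)
Fixpoint alt_sigma (R : list nat -> Prop) (m : nat) (b : bool) (l : list nat) : Prop :=
  match m with
  | 0 => if b then R l else ~ R l
  | S k => exists y, ~ alt_sigma R k (negb b) (y :: l)
  end.

Lemma qprefix_alt_sigma R m l :
  (qprefix m true R l <-> alt_sigma R m true l) /\ (qprefix m false R l <-> ~ alt_sigma R m false l).
Proof.
  revert l. induction m as [|m IH]; intros l; cbn [qprefix alt_sigma negb].
  - split; [tauto|]. split; [tauto | apply NNPP].
  - split.
    + split; intros [y Hy]; exists y; now apply IH.
    + split.
      * intros H [y Hy]. apply Hy, IH, H.
      * intros H y. apply IH. apply NNPP. intros Hn. apply H. now exists y.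
Qed.

(** * Persistence of refutations and truth in the limit *)

Lemma settled_ext Y e b s t l : extends Y s t -> settled (qst e b s l) -> settled (qst e b t l).
Proof.
  intros H. assert (Hl := proj1 H). rewrite !settled_qst. intros (p & q & Hp & Hq & HD).
  exists p, q. split; [|split; [|assumption]]; intros i Hi.
  - destruct (Hp i Hi). split; [lia|]. now apply (extends_old _ _ _ _ H).
  - destruct (Hq i Hi). split; [lia|]. now rewrite <- (extends_old _ _ _ _ H).
Qed.

Lemma secured_ext E m e b s t l (Z Z' : set) : E 0 = settled -> (forall i, Z' i -> Z i) ->
  extends Z s t -> secured E m (qst e b s l) Z -> secured E m (qst e b t l) Z'.
Proof.
  intros HE HZ Hst. destruct m as [|m]; cbn [secured].
  - rewrite HE. eapply settled_ext. eassumption.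
  - intros H F HF. rewrite reach_qst. intros (r & y & Hr & Hy).
    destruct (extends_fin Z s r) as (F' & HF' & Hr').
    + eapply extends_trans; [|apply Hst | apply Hr]. intros i Hi. auto.
    + apply (H F' HF'). apply reach_qst. eauto.
Qed.

Definition limit (s : nat -> nat) : set := fun i => exists k, i < p1 (s k) /\ mem i (p2 (s k)).

Lemma chain (s : nat -> nat) (Z : nat -> set) :
  (forall k, extends (Z k) (s k) (s (S k))) -> (forall k i, Z (S k) i -> Z k i) ->
  forall k j, k <= j -> extends (Z k) (s k) (s j) /\ forall i, Z j i -> Z k i.
Proof.
  intros H1 H2 k j Hkj. induction Hkj as [|j Hkj [IH1 IH2]].
  - split; [apply extends_refl | tauto].
  - split; [eapply extends_trans; [|apply IH1 | apply H1]; assumption | auto].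
Qed.

Lemma limit_mem s Z : (forall k, extends (Z k) (s k) (s (S k))) -> (forall k i, Z (S k) i -> Z k i) ->
  forall k i, i < p1 (s k) -> (limit s i <-> mem i (p2 (s k))).
Proof.
  intros H1 H2 k i Hi. split; [|intros H; now exists k]. intros (j & Hj & Hm).
  destruct (Nat.le_ge_cases k j) as [H|H].
  - destruct (chain s Z H1 H2 k j H) as [He _]. now apply (extends_old _ _ _ _ He).
  - destruct (chain s Z H1 H2 j k H) as [He _]. now apply (extends_old _ _ _ _ He).
Qed.

(** Either the Sigma_(m+1) statement is refuted, or its matrix is realised at a witness [y]. *)
Definition decides (E : nat -> nat -> Prop) (m e b l s : nat) (Z : set) : Prop :=
  secured E (S m) (qst e b s l) Z \/ exists y, secured E m (qst e (1 - b) s (S (pr y l))) Z.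

(** Forcing equals truth. A true existential statement has a witness [y], whose matrix has the
    opposite bit. Computation, or a decision made lower down the chain, then gives [E] for this
    matrix at a later string, which a secured reservoir excludes. Decisions are needed for [m < n]
    only, which lets refutations reach level [n + 1]. *)
Lemma truth n K P E s Z e R :
  tower n K P E -> (forall k, P (Z k)) ->
  (forall k, extends (Z k) (s k) (s (S k))) -> (forall k i, Z (S k) i -> Z k i) ->
  (forall N, exists k, N <= p1 (s k)) ->
  (forall m e b l, m < n -> exists k, decides E m e b l (s k) (Z k)) ->
  (forall v, length v = n + 2 ->
     (R v -> eval (limit s) e v 1) /\ (~ R v -> eval (limit s) e v 0)) ->
  forall m b l k, m <= n + 1 -> m + length l = n + 2 ->
    secured E m (qst (cp e) (Nat.b2n b) (s k) (cl l)) (Z k) -> ~ alt_sigma R m b l.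
Proof.
  intros (HE0 & _ & _ & _ & _ & _ & Hans) HP Hext HZ Hlen Hdec HR.
  assert (Hch := chain s Z Hext HZ). assert (Hlim := limit_mem s Z Hext HZ).
  assert (Hneg : forall b, 1 - Nat.b2n b = Nat.b2n (negb b)) by now intros [].
  induction m as [m IH] using lt_wf_ind. intros b l k Hm Hl HS.
  destruct m as [|m].
  - cbn [secured] in HS. rewrite HE0, settled_qst in HS. destruct HS as (p & q & Hp & Hq & HD).
    assert (HEv : eval (limit s) e l (1 - Nat.b2n b)).
    { apply eval_Der. exists p, q. split; [|split; [|assumption]]; intros i Hi.
      - destruct (Hp i Hi). now apply (Hlim k).
      - destruct (Hq i Hi). now rewrite (Hlim k). }
    destruct (HR l Hl) as [R1 R2]. cbn [alt_sigma]. destruct b; cbn in HEv; intros H.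
    + discriminate (eval_fun _ _ _ _ _ HEv (R1 H)).
    + discriminate (eval_fun _ _ _ _ _ HEv (R2 H)).
  - cbn [alt_sigma]. intros [y Hy]. cbn [secured] in HS.
    assert (Hcontra : forall j, k <= j ->
              ~ E m (qst (cp e) (Nat.b2n (negb b)) (s j) (cl (y :: l)))).
    { intros j Hj HEj. destruct (extends_fin _ _ _ (proj1 (Hch k j Hj))) as (F & HF & HFe).
      apply (HS F HF). apply reach_qst. exists (s j), y. split; [assumption|].
      rewrite Hneg. exact HEj. }
    destruct m as [|m].
    + assert (HEv : eval (limit s) e (y :: l) (Nat.b2n b)).
      { destruct (HR (y :: l)) as [R1 R2]; [cbn; lia|]. cbn [alt_sigma] in Hy. destruct b; cbn in *.
        - apply R1, NNPP, Hy.
        - now apply R2. }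
      apply eval_Der in HEv as (p & q & Hp & Hq & HD).
      destruct (Hlen (p + q)) as [j Hj]. set (j' := Nat.max j k).
      assert (Hj' : p + q <= p1 (s j')).
      { destruct (Hch j j') as [He _]; [lia|]. destruct He as [He _]. lia. }
      apply (Hcontra j'); [lia|]. rewrite HE0. apply settled_qst. exists p, q.
      split; [|split].
      * intros i Hi. assert (Hlt := mem_lt _ _ Hi). split; [lia|]. apply Hlim; [lia | auto].
      * intros i Hi. assert (Hlt := mem_lt _ _ Hi). split; [lia|].
        rewrite <- Hlim by lia. auto.
      * replace (1 - Nat.b2n (negb b)) with (Nat.b2n b) by now destruct b. assumption.
    + destruct (Hdec m (cp e) (Nat.b2n (negb b)) (cl (y :: l))) as (j & [HSj|[y' HSj]]); [lia| |].
      * set (j' := Nat.max j k). destruct (Hch j j') as [He1 He2]; [lia|].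
        apply (secured_ext _ _ _ _ _ _ _ _ _ HE0 He2 He1) in HSj.
        apply (Hcontra j'); [lia|].
        destruct (Hans m) as (T & (_ & HT & _) & ->); [lia|]. intros HTz.
        destruct (HT _ HTz (Z j') (HP j')) as (F & HF & HFv). now apply (HSj F).
      * rewrite Hneg, Bool.negb_involutive in HSj.
        apply Hy. exists y'. rewrite Bool.negb_involutive.
        apply (IH m) with (k := j); [lia | lia | cbn [length] in *; lia | exact HSj].
Qed.

(** In the first case the witness [y] forces [x] into the set defined by program [c]; in the second
    [x] is forced out of it. *)
Definition diagonalizes (B : set) (E : nat -> nat -> Prop) (n c s : nat) (Z : set) : Prop :=
  exists x, (~ B x /\ exists y, secured E n (qst c 0 s (cl [y; x])) Z) \/
            (B x /\ secured E (S n) (qst c 1 s (cl [x])) Z).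

(** Turns refutability into refutation by the thinning that a negative answer provides. *)
Lemma secure n K P E m z (Gd : set -> Prop) Z : tower n K P E -> m <= n ->
  (forall Z N, Gd Z -> tle N K -> (forall Y, P Y -> P (cap Y N)) -> Gd (cap Z N)) ->
  Gd Z -> E m z -> exists Z', Gd Z' /\ (forall i, Z' i -> Z i) /\ secured E m z Z'.
Proof.
  intros (HE0 & _ & _ & _ & _ & _ & Hans) Hm HGd HZ HEz. destruct m as [|m].
  - exists Z. auto.
  - destruct (Hans m Hm) as (T & (_ & _ & HT) & HET). rewrite HET in HEz.
    destruct (HT z HEz) as (N & HN & HPN & HNv). exists (cap Z N).
    split; [now apply HGd|]. split; [now intros i []|].
    cbn [secured]. intros F HF. apply HNv. intros i Hi. now apply HF.
Qed.

(** The sequence of conditions inside [D]. Strings grow within [cap Z D]; as this set is in [P],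
    positive answers are realised inside [D], although the questions do not mention it. *)
Lemma generic n K P E B (D : set) (Gd : set -> Prop) Z0 : tower n K P E ->
  Gd Z0 -> (forall Z, Gd Z -> P Z /\ P (cap Z D)) ->
  (forall Z N, Gd Z -> tle N K -> (forall Y, P Y -> P (cap Y N)) -> Gd (cap Z N)) ->
  (forall c s Z, Gd Z -> exists s' Z', Gd Z' /\ (forall i, Z' i -> Z i) /\
     extends (cap Z D) s s' /\ diagonalizes B E n c s' Z') ->
  exists G, infinite_set G /\ (forall x, G x -> D x) /\ ~ Sigma0_rel n G B.
Proof.
  intros HTow HZ0 HGP HGN Htop. assert (HTow' := HTow).
  destruct HTow' as (HE0 & _ & Hnice & _ & _ & Hinf & Hans).
  destruct (dependent_choice (nat * set)%type (fun c => Gd (snd c))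
    (* Requirement [r] is a pair of a tag and data: [0] adds an element, [1] decides a statement of
       a lower level, any other tag diagonalizes against a program. *)
    (fun r c c' => extends (cap (snd c) D) (fst c) (fst c') /\ (forall i, snd c' i -> snd c i) /\
       let w := p2 r in
       match p1 r with
       | 0 => w < p1 (fst c') /\ exists x, w <= x /\ x < p1 (fst c') /\ mem x (p2 (fst c'))
       | 1 => p1 w < n ->
          decides E (p1 w) (p1 (p2 w)) (p1 (p2 (p2 w))) (p2 (p2 (p2 w))) (fst c') (snd c')
       | _ => diagonalizes B E n w (fst c') (snd c')
       end) (pr 0 0, Z0)) as (f & Hf0 & Hf).
  - exact HZ0.
  - intros r [s Z] HZ. cbn [fst snd] in *. cbv zeta. set (w := p2 r).
    destruct (p1 r) as [|[|k]].
    + destruct (Hinf _ (proj2 (HGP Z HZ)) (w + p1 s)) as (x & Hx & HZx).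
      exists (pr (S x) (Nat.setbit (tr (fun i => mem i (p2 s)) (p1 s)) x), Z).
      cbn [fst snd]. spr. split; [assumption|]. split; [|split; [tauto|]].
      * apply extends_intro; spr; [lia| |].
        -- intros i Hi. rewrite mem_setbit, mem_tr. intuition lia.
        -- intros i Hi Hs [->|Hm]%mem_setbit; [assumption|]. apply mem_tr in Hm. lia.
      * split; [lia|]. exists x. rewrite mem_setbit. split; [lia|]. split; [lia | tauto].
    + destruct (le_lt_dec n (p1 w)) as [Hn|Hn].
      { exists (s, Z). split; [assumption|]. split; [apply extends_refl|]. split; [tauto|]. lia. }
      destruct (Hans _ Hn) as (T & (_ & HT1 & HT2) & HET).
      set (z := qst (p1 (p2 w)) (p1 (p2 (p2 w))) s (p2 (p2 (p2 w)))).
      destruct (classic (T z)) as [HTz|HTz].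
      * destruct (HT1 z HTz _ (proj2 (HGP Z HZ))) as (F & HF & HFv).
        unfold z in HFv. rewrite reach_qst in HFv. destruct HFv as (t & y & Ht & HEt).
        destruct (secure n K P E (p1 w) _ Gd Z HTow (Nat.lt_le_incl _ _ Hn) HGN HZ HEt)
          as (Z' & HZ' & HZZ & HSec).
        exists (t, Z'). cbn [fst snd]. split; [assumption|].
        split; [eapply extends_mono; [|apply Ht]; exact HF|]. split; [assumption|].
        intros _. right. eauto.
      * destruct (HT2 z HTz) as (N & HN & HPN & HNv). exists (s, cap Z N).
        cbn [fst snd]. split; [now apply HGN|]. split; [apply extends_refl|].
        split; [now intros i []|]. intros _. left. cbn [secured]. intros F HF. apply HNv.
        intros i Hi. now apply HF.
    + destruct (Htop w s Z HZ) as (s' & Z' & H1 & H2 & H3 & H4). exists (s', Z'). auto.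
  - set (s := fun k => fst (f k)). set (Z := fun k => snd (f k)).
    assert (Hext : forall k, extends (cap (Z k) D) (s k) (s (S k))) by (intros k; apply (Hf k)).
    assert (HZ : forall k i, Z (S k) i -> Z k i) by (intros k; apply (Hf k)).
    assert (Hext' : forall k, extends (Z k) (s k) (s (S k))).
    { intros k. eapply extends_mono; [|apply Hext]. now intros i []. }
    assert (Hgrow : forall N, N < p1 (s (S (pr 0 N))) /\
              exists x, N <= x /\ x < p1 (s (S (pr 0 N))) /\ mem x (p2 (s (S (pr 0 N))))).
    { intros N. destruct (Hf (pr 0 N)) as (_ & _ & _ & H). cbv zeta in H. spr. exact H. }
    exists (limit s). split; [|split].
    + intros N. destruct (Hgrow N) as (_ & x & Hx & Hlx & Hm). exists x.
      split; [assumption|]. eexists. eauto.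
    + intros x (k & Hk & Hm). revert Hk Hm. induction k as [|k IH].
      * unfold s. rewrite Hf0. cbn [fst]. spr. lia.
      * intros Hk Hm. destruct (le_lt_dec (p1 (s k)) x) as [H|H].
        -- now destruct (extends_new _ _ _ _ (Hext k) Hk H Hm).
        -- apply IH; [assumption|]. now apply (extends_old _ _ _ _ (Hext k)).
    + intros (R & (e & He) & HBR).
      assert (Htr := truth n K P E s Z e R HTow).
      assert (HP : forall k, P (Z k)) by (intros k; apply HGP, (Hf k)).
      specialize (Htr HP Hext' HZ).
      assert (H1 : forall N, exists k, N <= p1 (s k)).
      { intros N. eexists. apply Nat.lt_le_incl, Hgrow. }
      assert (H2 : forall m e b l, m < n -> exists k, decides E m e b l (s k) (Z k)).
      { intros m c b l Hm. exists (S (pr 1 (pr m (pr c (pr b l))))).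
        destruct (Hf (pr 1 (pr m (pr c (pr b l))))) as (_ & _ & _ & H). cbv zeta in H. spr.
        now apply H. }
      specialize (Htr H1 H2 He).
      destruct (Hf (pr 2 (cp e))) as (_ & _ & _ & H). cbv zeta in H. spr.
      destruct H as [x [[HBx [y Hy]]|[HBx Hx]]].
      * apply HBx, HBR, qprefix_alt_sigma. rewrite Nat.add_1_r. cbn [alt_sigma]. exists y.
        apply (Htr n false [y; x] (S (pr 2 (cp e)))); [lia | cbn; lia | exact Hy].
      * apply HBR, qprefix_alt_sigma in HBx. rewrite Nat.add_1_r in HBx. revert HBx.
        apply (Htr (S n) true [x] (S (pr 2 (cp e)))); [lia | cbn; lia | exact Hx].
Qed.

(** The event [q] replaces extensions outside [D]: it cannot occur there when [x] is not in [B], and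
    occurs in all reservoirs when [x] is in [B]. So a comparison of [B] with a question about
    2-partitions is always resolved inside [D]. *)
Lemma blocked n K P E B (D : set) Zb q : tower n K P E ->
  let good := fun Z => P Z /\ ~ re (join K Z) B in
  let below := fun Z : set => good Z /\ forall i, Z i -> Zb i in
  good Zb -> re K (fun z => q (p1 z) (p2 z)) ->
  (forall Z, below Z -> P (cap Z D)) ->
  (forall Z x, below Z -> ~ B x -> ~ exists F, sub F (cap Z (compl D)) /\ q x F) ->
  (forall Z x, below Z -> B x -> exists F, sub F Z /\ q x F) ->
  exists G, infinite_set G /\ (forall x, G x -> D x) /\ ~ Sigma0_rel n G B.
Proof.
  intros HTow good below Hb Hq Ha Hneg Hpos. assert (HTow' := HTow).
  destruct HTow' as (HE0 & HEn & Hnice & Hp & _ & _ & _).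
  assert (HN : forall Z N, below Z -> tle N K -> (forall Y, P Y -> P (cap Y N)) -> below (cap Z N)).
  { intros Z N [[HPZ HZ] HZb] HNK HPN. split; [|intros i []; auto].
    split; [auto | now apply not_re_join_cap]. }
  apply (generic n K P E B D below Zb HTow); [split; auto | intros Z HZ; split; [apply HZ | auto] | assumption |].
  intros c s Z HZ. assert (HZ' := HZ). destruct HZ' as [HgZ HZb].
  set (z := fun x => qst c 1 s (cl [x])).
  (* [empty_class (Rx x)] says that each 2-partition of [Z] permits forcing [x] in by the first part
     or the event [q] in the second. It is enumerable in [K] joined with [Z], hence is not [B]. *)
  set (Rx := fun x t => (sub (p1 t) Z /\ reach (E n) (z x) (p1 t)) \/ (sub (p2 t) Z /\ q x (p2 t))).
  assert (HRx : re (join K Z) (fun y => Rx (p1 y) (p2 y))).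
  { destruct (tle_join_r K Z) as [Z1 _].
    assert (Hq' := re_tle _ _ _ (tle_join_l K Z) Hq).
    assert (Hv := re_tle _ _ _ (tle_join_l K Z) (re_reach _ _ HEn)).
    unfold Rx, z, sub, qst. cbn [cl]. re_tac. }
  assert (HS : exists x, ~ (B x <-> empty_class (Rx x))).
  { apply NNPP. intros Hn. apply (proj2 HgZ). apply (re_ext _ (fun x => empty_class (Rx x))).
    - intros x. apply NNPP. intros Hx. apply Hn. exists x. intros Hx'. apply Hx. now symmetry.
    - now apply re_empty_class. }
  destruct HS as [x Hx]. destruct (classic (B x)) as [HBx|HBx].
  - assert (HE : ~ empty_class (Rx x)) by tauto.
    assert (HRxx : re (join K Z) (Rx x)).
    { apply (re_ext _ (fun t => Rx (p1 (pr x t)) (p2 (pr x t)))); [intros t; now spr|].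
      apply (re_sub _ (fun y => Rx (p1 y) (p2 y))); [fn_tac | assumption]. }
    destruct (basis_avoid _ B _ (proj2 HgZ) HRxx HE) as (Y & HY & HBY).
    assert (Hgood : forall X, tle X (join (join K Z) Y) -> P X -> good X).
    { intros X HX HPX. split; [assumption|]. intros HB. apply HBY. eapply re_tle; [|apply HB].
      apply join_tle; [|assumption]. eapply tle_trans; [apply (tle_join_l K Z) | apply tle_join_l]. }
    assert (HZJ : tle Z (join (join K Z) Y)) by (eapply tle_trans; [apply (tle_join_r K Z) | apply tle_join_l]).
    assert (HYJ := tle_join_r (join K Z) Y).
    (* [Y] is a partition permitting neither. If its first part is large, it forces [x] out; if the
       second is, [Hpos] yields the event. *)
    destruct (Hp Z Y (proj1 HgZ)) as [HP0|HP1].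
    + exists s, (cap Z Y). split; [split|split; [|split]].
      * apply Hgood; [now apply tle_cap | assumption].
      * intros i []. auto.
      * now intros i [].
      * apply extends_refl.
      * exists x. right. split; [assumption|]. cbn [secured]. intros F HF HFv.
        apply (HY F 0); [intros i Hi; now apply HF | apply dis_0|]. left. spr.
        split; [|assumption]. intros i Hi. now apply HF.
    + exfalso. destruct (Hpos (diff Z Y) x) as (F & HF & HFq); [|assumption|].
      * split; [|intros i []; auto]. apply Hgood; [now apply tle_diff | assumption].
      * apply (HY 0 F); [apply sub_0 | intros i Hi; now apply HF|]. right. spr.
        split; [|assumption]. intros i Hi. now apply HF.
  - assert (HE : empty_class (Rx x)) by (destruct (classic (empty_class (Rx x))); tauto).
    (* Only here is the partition given by [D] itself used; the event in the second part is excluded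
       by [Hneg]. *)
    destruct (empty_class_sound _ D HE) as (p & r & Hpp & Hr & [[HpZ Hv]|[HrZ Hqr]]); spr.
    + unfold z in Hv. rewrite reach_qst in Hv. destruct Hv as (t & y & Ht & HEt).
      destruct (secure n K P E n _ below Z HTow (Nat.le_refl n) HN HZ HEt)
        as (Z' & HZ' & HZZ & HSec).
      exists t, Z'. split; [assumption|]. split; [assumption|]. split.
      * eapply extends_mono; [|apply Ht]. intros i Hi. split; auto.
      * exists x. left. split; [assumption|]. now exists y.
    + elim (Hneg Z x HZ HBx). exists r. split; [|assumption]. intros i Hi. split; auto.
Qed.

Theorem theorem4p10 :
  forall (n : nat) (B : nat -> Prop),
    ~ Sigma0 n B ->
    forall A : nat -> Prop,
      exists G : nat -> Prop,
        infinite_set G /\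
        ((forall x, G x -> A x) \/ (forall x, G x -> ~ A x)) /\
        ~ Sigma0_rel n G B.
Proof.
  intros n B HB A.
  destruct (tower_ex B n 0) as (K & P & E & HTow & HBK).
  { rewrite Nat.add_0_r. intros H. now apply HB, re_jumpn_Sigma0. }
  cbn [jumpn] in HBK. assert (HTow' := HTow).
  destruct HTow' as (HE0 & HEn & Hnice & Hp & HPT & Hinf & _).
  set (good := fun Z => P Z /\ ~ re (join K Z) B).
  assert (HgT : good (fun _ => True)).
  { split; [assumption|]. intros H. apply HBK. eapply re_tle; [|apply H].
    apply join_tle; [apply tle_refl|].
    split; apply re_ce, ce_dec.
    - apply (dec_ext (fun _ => 0 = 0)); [tauto|]. apply dec_eq; fn_tac.
    - apply (dec_ext (fun _ => 0 = 1)); [|apply dec_eq; fn_tac]. intros x. split; [discriminate | tauto]. }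
  (* If [compl D] is small in [Zb], some index [i] of the Pi^0_2 definition of [P] fails there.
     [Q i] then serves as the event for all [x]: it never occurs outside [D], and occurs in each
     member of [P]. *)
  assert (HcaseI : forall D Zb, good Zb -> ~ P (cap Zb (compl D)) ->
    exists G, infinite_set G /\ (forall x, G x -> D x) /\ ~ Sigma0_rel n G B).
  { intros D Zb HZb HnP. assert (Hnice' := Hnice). destruct Hnice' as (Q & HQ & HPQ).
    assert (Hi : exists i, ~ exists F, sub F (cap Zb (compl D)) /\ Q i F).
    { apply NNPP. intros Hn. apply HnP, HPQ. intros i. apply NNPP. intros Hi. apply Hn. eauto. }
    destruct Hi as [i Hi].
    apply (blocked n K P E B D Zb (fun _ F => Q i F) HTow HZb).
    - re_tac.
    - intros Z [[HPZ _] HZZ]. destruct (Hp Z D HPZ) as [|Hd]; [assumption|].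
      elim HnP. eapply pi2_family_up; [eassumption| |apply Hd]. intros j [H1 H2]. split; auto.
    - intros Z x [_ HZZ] _ (F & HF & HFQ). apply Hi. exists F. split; [|assumption].
      intros j Hj. destruct (HF j Hj). split; auto.
    - intros Z x [[HPZ _] _] _. destruct (proj1 (HPQ Z) HPZ i) as (F & HF & HFQ). eauto. }
  destruct (classic (exists Zb, good Zb /\ ~ P (cap Zb (compl A)))) as [(Zb & H1 & H2)|HA].
  { destruct (HcaseI A Zb H1 H2) as (G & ? & ? & ?). exists G. auto. }
  destruct (classic (exists Zb, good Zb /\ ~ P (cap Zb (compl (compl A))))) as [(Zb & H1 & H2)|HA'].
  { destruct (HcaseI (compl A) Zb H1 H2) as (G & ? & ? & ?). exists G. auto. }
  assert (HPA : forall Z, good Z -> P (cap Z (compl A))).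
  { intros Z HZ. apply NNPP. intros Hn. apply HA. eauto. }
  assert (HPA' : forall Z, good Z -> P (cap Z A)).
  { intros Z HZ. eapply pi2_family_up; [eassumption| |apply (NNPP _ (fun Hn => HA' (ex_intro _ Z (conj HZ Hn))))].
    intros i [H1 H2]. split; [assumption | now apply NNPP]. }
  assert (HN : forall Z N, good Z -> tle N K -> (forall Y, P Y -> P (cap Y N)) -> good (cap Z N)).
  { intros Z N [HPZ HZ] HNK HPN. split; [auto | now apply not_re_join_cap]. }
  (* Both sides are now large in each good reservoir. Either the complement of [A] can always
     diagonalize, or it is stuck at some [c], [s] and [Zb]. *)
  destruct (classic (forall c s Z, good Z -> exists s' Z', good Z' /\ (forall i, Z' i -> Z i) /\
     extends (cap Z (compl A)) s s' /\ diagonalizes B E n c s' Z')) as [Hgen|Hblock].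
  { destruct (generic n K P E B (compl A) good (fun _ => True) HTow) as (G & ? & ? & ?);
      [assumption | intros Z HZ; split; [apply HZ | auto] | assumption | assumption |].
    exists G. auto. }
  apply not_all_ex_not in Hblock as [c Hblock]. apply not_all_ex_not in Hblock as [s Hblock].
  apply not_all_ex_not in Hblock as [Zb Hblock]. apply imply_to_and in Hblock as [HZb Hblock].
  (* The event is that program [c] can be made to accept [x] from [s]. Its occurrence outside [A]
     for [x] not in [B], or its absence from a reservoir for [x] in [B], would have diagonalized on
     the stuck side. *)
  destruct (blocked n K P E B A Zb (fun x F => reach (E n) (qst c 1 s (cl [x])) F) HTow HZb)
    as (G & ? & ? & ?); [| | | |exists G; auto].
  - assert (Hv := re_reach _ _ HEn). unfold qst. cbn [cl]. re_tac.
  - intros Z [HZ _]. auto.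
  - intros Z x [HZ HZZ] HBx (F & HF & HFv). rewrite reach_qst in HFv.
    destruct HFv as (t & y & Ht & HEt).
    destruct (secure n K P E n _ good Z HTow (Nat.le_refl n) HN HZ HEt) as (Z' & HZ' & HZZ' & HSec).
    apply Hblock. exists t, Z'. split; [assumption|]. split; [auto|]. split.
    + eapply extends_mono; [|apply Ht]. intros i Hi. destruct (HF i Hi). split; auto.
    + exists x. left. split; [assumption|]. now exists y.
  - intros Z x [HZ HZZ] HBx. apply NNPP. intros Hn. apply Hblock. exists s, Z.
    split; [assumption|]. split; [assumption|]. split; [apply extends_refl|]. exists x. right.
    split; [assumption|]. cbn [secured]. intros F HF HFv. apply Hn. eauto.
Qed.
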